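(* Let $\Gamma$ be a countable group. If $\Gamma$ has the unique trace property then $\Gamma$ is shift-minimal.
   Context: All groups are countable and discrete. $C^*_r(\Gamma)$ is the reduced $C^*$-algebra of $\Gamma$, i.e. the $C^*$-algebra generated by the operators $\lambda_\Gamma(\gamma)$, $\gamma\in\Gamma$, in $B(\ell^2(\Gamma))$, with $\lambda_\Gamma$ the left regular representation. $\Gamma$ has the unique trace property if there is a unique tracial state on $C^*_r(\Gamma)$. A measure preserving (m.p.) action $\boldsymbol a=\Gamma\curvearrowright^a(X,\mu)$ is a Borel action of $\Gamma$ on a standard probability space (possibly with atoms) preserving $\mu$. It is trivial if $\mu$ is a point mass, and non-trivial otherwise. It is free if $\mu(\{x:\gamma^a x=x\})=0$ for every $\gamma\in\Gamma\setminus\{e\}$. For m.p. actions $\boldsymbol a=\Gamma\curvearrowright^a(X,\mu)$ and $\boldsymbol b=\Gamma\curvearrowright^b(Y,\nu)$, $\boldsymbol a$ is weakly contained in $\boldsymbol b$ (written $\boldsymbol a\prec\boldsymbol b$) if for all Borel $A_1,\dots,A_n\subseteq X$, finite $F\subseteq\Gamma$ and $\epsilon>0$ there are Borel $B_1,\dots,B_n\subseteq Y$ with $|\mu(\gamma^aA_i\cap A_j)-\nu(\gamma^bB_i\cap B_j)|<\epsilon$ for all $\gamma\in F$, $i,j\le n$. The Bernoulli shift $\boldsymbol s_\Gamma$ is the m.p. action of $\Gamma$ on $([0,1]^\Gamma,\lambda^\Gamma)$ ($\lambda$ Lebesgue measure) given by $(\gamma f)(\delta)=f(\gamma^{-1}\delta)$.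 $\Gamma$ is shift-minimal if every non-trivial m.p. action of $\Gamma$ weakly contained in $\boldsymbol s_\Gamma$ is free. *)

(* Defs.v *)
From HB Require Import structures.
From mathcomp Require Import all_boot all_order all_algebra finmap complex.
From mathcomp Require Import all_classical all_reals all_analysis.
From mathcomp Require Import ring.
From mathcomp.analysis.showcase Require summability.

Set Implicit Arguments.
Unset Strict Implicit.
Unset Printing Implicit Defensive.

Import Order.TTheory GRing.Theory Num.Theory.
Import numFieldNormedType.Exports.

Local Open Scope classical_set_scope.
Local Open Scope ring_scope.
Local Open Scope complex_scope.

Section SquareSummable.
Variables (R : realType) (G : choiceType).

Definition sqsum (x : G -> R[i]) : \bar R :=
  \esum_(g in [set: G]) (ComplexField.Normc.normc (x g) ^+ 2)%:E.

Definition square_summable : {pred G -> R[i]} := mem [set x | (sqsum x < +oo)%E].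

Lemma square_summableP x : reflect (sqsum x < +oo)%E (x \in square_summable).
Proof. by apply: (iffP idP); rewrite inE. Qed.

Lemma square_summable_submod_closed : submod_closed square_summable.
Proof.
have scal_oo (k : R) (z : G -> R[i]) : (sqsum z < +oo)%E ->
    (\esum_(g in [set: G])
       ((k ^+ 2 * ComplexField.Normc.normc (z g) ^+ 2)%:E) < +oo)%E.
  move=> zoo; apply: (@le_lt_trans _ _ ((k ^+ 2)%:E * sqsum z)%E); last first.
    by apply: lte_mul_pinfty; rewrite // lee_fin sqr_ge0.
  apply: ge_ereal_sup => _ [F F_fin <-] /=.
  under eq_fsbigr do rewrite EFinM.
  rewrite -ge0_mule_fsumr => [|g]; last by rewrite lee_fin sqr_ge0.
  by apply: lee_wpmul2l; [rewrite lee_fin sqr_ge0 | apply: ereal_sup_ubound; exists F].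
split=> [|a x y /square_summableP xoo /square_summableP yoo].
  apply/square_summableP; rewrite /sqsum esum1 // => g _.
  by rewrite ComplexField.Normc.normc0 expr0n.
apply/square_summableP.
have s2 : Num.sqrt (2 : R) ^+ 2 = 2 by rewrite sqr_sqrtr.
pose b := Num.sqrt (2 : R) * ComplexField.Normc.normc a.
apply: (@le_lt_trans _ _ (\esum_(g in [set: G])
    ((b ^+ 2 * ComplexField.Normc.normc (x g) ^+ 2)%:E +
     (Num.sqrt (2 : R) ^+ 2 * ComplexField.Normc.normc (y g) ^+ 2)%:E))%E).
  apply: le_esum => g _; rewrite -EFinD lee_fin exprMn s2 -mulrA -exprMn.
  rewrite -ComplexField.Normc.normcM -mulrDr.
  set u := a * x g.
  have := le_normcD u (y g); rewrite -/(ComplexField.Normc.normc _).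
  have -> : (a *: x + y) g = u + y g by [].
  move: (ComplexField.Normc.normc u) (ComplexField.Normc.normc (y g)) => p q le_pq.
  have n0 : 0 <= ComplexField.Normc.normc (u + y g) by case: (u + y g) => ? ?; exact: sqrtr_ge0.
  apply: (@le_trans _ _ ((p + q) ^+ 2)); first by rewrite !expr2 ler_pM.
  rewrite -subr_ge0 (_ : _ - _ = (p - q) ^+ 2) ?sqr_ge0 //.
  by ring.
rewrite esumD => [|g _|g _]; try by rewrite lee_fin mulr_ge0 ?sqr_ge0.
by rewrite lte_add_pinfty ?scal_oo.
Qed.

HB.instance Definition _ :=
  GRing.isSubmodClosed.Build R[i] (G -> R[i]) square_summable
    square_summable_submod_closed.

Definition l2 : Type := {x : G -> R[i] | x \in square_summable}.

HB.instance Definition _ := SubChoice.on l2.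
HB.instance Definition _ := [SubChoice_isSubLmodule of l2 by <:].

Definition l2norm (x : l2) : R := Num.sqrt (fine (sqsum (\val x))).

(* The family is absolutely summable by the Cauchy-Schwarz inequality, so its
   sum is the limit of its partial sums along the net of finite subsets of G. *)
Definition l2dot (x y : l2) : R[i] :=
  @summability.sum G R[i] R[i]^o (fun g => \val x g * (\val y g)^*).

Definition bounded_operator : set (l2 -> l2) :=
  [set T | linear T /\ exists M, forall x, l2norm (T x) <= M * l2norm x].

Definition opnorm (T : l2 -> l2) : R :=
  sup [set l2norm (T x) | x in [set x | l2norm x <= 1]].

Definition adjoint (T S : l2 -> l2) : Prop :=
  forall x y, l2dot (T x) y = l2dot x (S y).

Record Cstar_subalgebra (A : set (l2 -> l2)) : Prop := {
  Cstar_bounded : A `<=` bounded_operator ;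
  Cstar0 : A 0 ;
  CstarD : forall S T, A S -> A T -> A (S + T) ;
  CstarZ : forall (a : R[i]) T, A T -> A (a *: T) ;
  CstarM : forall S T, A S -> A T -> A (S \o T) ;
  Cstar_adjoint : forall T S, A T -> adjoint T S -> A S ;
  Cstar_closed : forall (u : nat -> l2 -> l2) T, (forall n, A (u n)) ->
    bounded_operator T -> opnorm (u n - T) @[n --> \oo] --> (0 : R) -> A T
}.

Record tracial_state (A : set (l2 -> l2)) (tau : (l2 -> l2) -> R[i]) : Prop := {
  tracial_linear : forall (a : R[i]) S T, A S -> A T ->
    tau (a *: S + T) = a * tau S + tau T ;
  tracial_positive : forall T S, A T -> adjoint T S -> 0 <= tau (S \o T) ;
  tracial_unital : tau idfun = 1 ;
  tracial_comm : forall S T, A S -> A T -> tau (S \o T) = tau (T \o S)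
}.

End SquareSummable.

Section ReducedCstarAlgebra.
Variables (R : realType) (G : groupType).

Lemma square_summable_translate (g : G) (x : G -> R[i]) :
  x \in @square_summable R G ->
  (fun h => x (g^-1 * h)%g) \in @square_summable R G.
Proof.
move=> /square_summableP xoo; apply/square_summableP; move: xoo; congr (_ < _)%E.
rewrite /sqsum (reindex_esum [set: G] [set: G] (fun h => (g^-1 * h)%g)) //.
rewrite setTT_bijective.
by exists (fun h => (g * h)%g) => h; rewrite ?mulKg ?mulVKg.
Qed.

Definition left_regular (g : G) (x : l2 R G) : l2 R G :=
  Sub (fun h => \val x (g^-1 * h)%g) (square_summable_translate g (valP x)).

Definition reduced_Cstar : set (l2 R G -> l2 R G) :=
  smallest (@Cstar_subalgebra R G) (range left_regular).

(* Only the values of a functional on the algebra matter. *)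
Definition unique_trace_property : Prop :=
  exists2 tau, tracial_state reduced_Cstar tau &
    forall tau', tracial_state reduced_Cstar tau' ->
      forall T, reduced_Cstar T -> tau' T = tau T.

End ReducedCstarAlgebra.

Section Actions.
Variables (R : realType) (G : groupType).

(* A Polish space is a separable Hausdorff space whose topology is given by a
   complete metric. *)
Definition standard_borel d (X : measurableType d) : Prop :=
  exists (P : completePseudoMetricType R) (f : X -> P),
    [/\ hausdorff_space P,
        (exists2 D : set P, countable D & dense D),
        bijective f &
        measurable = preimage_set_system [set: X] f <<s open >>].

Definition mp_action d (X : measurableType d) (mu : probability X R)
    (a : G -> X -> X) : Prop :=
  [/\ forall x, a 1%g x = x,
      forall g h x, a (g * h)%g x = a g (a h x),
      forall g, measurable_fun [set: X] (a g) &
      forall g A, measurable A -> mu (a g @^-1` A) = mu A].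

Definition point_mass d (X : measurableType d) (mu : probability X R) : Prop :=
  exists x, forall A, measurable A -> mu A = \d_x A.

Definition free_action d (X : measurableType d) (mu : probability X R)
    (a : G -> X -> X) : Prop :=
  forall g, g != 1%g -> mu [set x | a g x = x] = 0%E.

Definition weakly_contained d (X : measurableType d) (mu : probability X R)
    (a : G -> X -> X) d' (Y : measurableType d') (nu : probability Y R)
    (b : G -> Y -> Y) : Prop :=
  forall (n : nat) (A : 'I_n -> set X) (F : {fset G}) (e : R),
    (forall i, measurable (A i)) -> 0 < e ->
    exists2 B : 'I_n -> set Y, (forall i, measurable (B i)) &
      forall g i j, g \in F ->
        `| fine (mu ((a g @` A i) `&` A j)) -
           fine (nu ((b g @` B i) `&` B j)) | < e.

End Actions.

Section BernoulliShift.
Variables (R : realType) (G : groupType).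

Definition unit_interval : Type := {x : R | 0 <= x <= 1}.

HB.instance Definition _ := SubChoice.on unit_interval.

Lemma unit_interval0_proof : 0 <= (0 : R) <= 1.
Proof. by rewrite lexx ler01. Qed.

HB.instance Definition _ :=
  isPointed.Build unit_interval (exist _ 0 unit_interval0_proof).

Definition I01 : measurableType _ :=
  @g_sigma_algebra_preimageType _ unit_interval
    (measurableTypeR R) (fun x => \val x : measurableTypeR R).

Definition shift_space : measurableType _ :=
  g_sigma_algebraType (\bigcup_g
    preimage_set_system [set: G -> I01] (fun f => f g) measurable).

(* The product measure lambda^G is the unique probability measure on the
   product sigma-algebra with these values on the measurable cylinders. *)
Definition product_lebesgue (P : probability shift_space R) : Prop :=
  forall (F : {fset G}) (A : G -> set I01), (forall g, measurable (A g)) ->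
    P [set f | forall g, g \in F -> A g (f g)] =
      (\prod_(g <- F) @lebesgue_measure R ((fun x : I01 => \val x) @` A g))%E.

Definition bernoulli_shift (g : G) (f : shift_space) : shift_space :=
  fun h => f (g^-1 * h)%g.

(* P is the measure lambda^G: it exists and is unique, so quantifying over P
   fixes the Bernoulli shift. *)
Definition shift_minimal : Prop :=
  forall P : probability shift_space R, product_lebesgue P ->
  forall d (X : measurableType d) (mu : probability X R) (a : G -> X -> X),
    standard_borel R X -> mp_action mu a -> ~ point_mass mu ->
    weakly_contained mu a P bernoulli_shift -> free_action mu a.

End BernoulliShift.

(* Main.v *)
(* Call a symmetric positive definite function phi on G tempered when
   |phi(f)| <= phi(1) ||lambda(f)|| for every f in the group ring.  A tempered
   phi with phi(1) = 1 that is constant on conjugacy classes extends by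
   continuity to a trace on the reduced C*-algebra; so does the indicator of 1,
   and under the unique trace property phi must vanish off 1.

   A finitely supported positive definite phi is tempered: iterating
   |phi(f)|^2 <= phi(1) phi(f^* f), the 2^n-th power of |phi(f)| is bounded by
   phi(1)^(2^n - 1) |phi(F)| for some F with ||lambda(F)|| <= ||lambda(f)||^(2^n),
   and |phi(F)| <= K ||lambda(F)|| because the support is finite.  For a set B
   depending on finitely many coordinates of the Bernoulli shift, the function
   g |-> P(gB n B) - P(B)^2 is of this kind by independence.  Temperedness is
   stable under sums and pointwise limits, hence it holds for all measurable B,
   and, by weak containment, for the corresponding functions of the action.

   Suppose mu has no atoms.  Summing these functions over the cells of finer and
   finer partitions gives in the limit g |-> mu(Fix g), which is therefore
   tempered and must vanish off 1.

   If mu is not a point mass but has an atom, of mass p say, sum over the finite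
   set of atoms of mass p: the result is constant on conjugacy classes and
   positive at every g that fixes all of them.  Such a g different from 1 exists
   when G is infinite, contradicting the unique trace property.  A finite G is
   trivial, because the constant function 1 is tempered. *)
From HB Require Import structures.
Require Import Defs.
From mathcomp Require Import all_boot all_order all_algebra finmap complex.
From mathcomp Require Import all_classical all_reals all_analysis.
From mathcomp Require Import ring lra.
From mathcomp.analysis.showcase Require summability.

Set Implicit Arguments.
Unset Strict Implicit.
Unset Printing Implicit Defensive.

Import Order.TTheory GRing.Theory Num.Theory.
Import numFieldNormedType.Exports.

Local Open Scope classical_set_scope.
Local Open Scope ring_scope.
Local Open Scope complex_scope.

(** * The Hilbert space l2 *)

Reserved Notation "z ^cj" (at level 1, left associativity, format "z ^cj").
Notation "z ^cj" := (conjc z) : ring_scope.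
Notation normc := ComplexField.Normc.normc.

Section ComplexModulus.
Variable R : realType.
Implicit Types z w : R[i].

Lemma normcE_norm z : (normc z)%:C = `|z|.
Proof. by case: z. Qed.

Lemma normc_ge0 z : 0 <= normc z.
Proof. by case: z => a b; exact: sqrtr_ge0. Qed.

Lemma normcD z w : normc (z + w) <= normc z + normc w.
Proof. exact: le_normcD. Qed.

Lemma normcM z w : normc (z * w) = normc z * normc w.
Proof. exact: ComplexField.Normc.normcM. Qed.

Lemma conjcD z w : (z + w)^cj = z^cj + w^cj.
Proof. by case: z => a b; case: w => c d /=; apply/eqP; rewrite eq_complex /= opprD !eqxx. Qed.

Lemma conjcN z : (- z)^cj = - z^cj.
Proof. by case: z. Qed.

Lemma conjcM z w : (z * w)^cj = z^cj * w^cj.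
Proof.
case: z => a b; case: w => c d; apply/eqP; rewrite eq_complex /=.
by apply/andP; split; apply/eqP; ring.
Qed.

Lemma real_complexM (a b : R) : (a * b)%:C = a%:C * b%:C.
Proof. exact: rmorphM. Qed.

Lemma normc_sqr z : (normc z ^+ 2)%:C = z * z^cj.
Proof. by rewrite -sqr_normc -normcE_norm rmorphXn. Qed.

Lemma normcR (r : R) : normc r%:C = `|r|.
Proof. by rewrite /= expr0n addr0 sqrtr_sqr. Qed.

Lemma Re_le_normc z : complex.Re z <= normc z.
Proof.
by apply: (le_trans (ler_norm _)); rewrite -lecR normcE_norm normc_ge_Re.
Qed.

Lemma normcB z w : normc (z - w) = normc (w - z).
Proof. by rewrite -opprB; apply: normcN. Qed.

Lemma normc_sum (I : Type) (s : seq I) (F : I -> R[i]) :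
  normc (\sum_(i <- s) F i) <= \sum_(i <- s) normc (F i).
Proof.
elim/big_rec2: _ => [|i a b _ h]; first by rewrite ComplexField.Normc.normc0.
by apply: (le_trans (normcD _ _)); rewrite lerD2l.
Qed.

End ComplexModulus.

Lemma ler_fset_sum (R : numDomainType) (I : choiceType) (f : I -> R) (A B : {fset I}) :
  (forall i, 0 <= f i) -> (A `<=` B)%fset ->
  \sum_(i <- A) f i <= \sum_(i <- B) f i.
Proof.
move=> f0 AB; pose h i := if i \in A then f i else 0.
have -> : \sum_(i <- A) f i = \sum_(i <- A) h i.
  by apply: eq_big_seq => i; rewrite /h => ->.
rewrite (big_fset_incl _ AB) => [|i _ /negPf iA]; last by rewrite /h iA.
by apply: ler_sum => i _; rewrite /h; case: ifP.
Qed.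

Section InnerProduct.
Variables (R : realType) (G : choiceType).
Implicit Types (x y z : l2 R G) (c : R[i]).

Variant has_sum (f : G -> R[i]) (s : R[i]) : Prop :=
  HasSum of summability.partial_sum f @ summability.totally --> (s : R[i]^o).

Lemma has_sum_unique f s : has_sum f s ->
  @summability.sum G R[i] R[i]^o f = s.
Proof.
move=> [fs]; have := @cvg_lim R[i]^o (@norm_hausdorff _ R[i]^o) _ _
  (@summability.totally_filter G) (summability.partial_sum f) s fs.
exact.
Qed.

Lemma has_sumD f g s t : has_sum f s -> has_sum g t ->
  has_sum (fun i => f i + g i) (s + t).
Proof.
move=> [fs] [gt]; split.
rewrite (_ : summability.partial_sum _ =
  summability.partial_sum f \+ summability.partial_sum g); last first.
  by apply/funext => A; rewrite /summability.partial_sum /= big_split.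
have := @cvgD _ R[i]^o _ _ (summability.totally_filter : Filter _) _ _ _ _ fs gt.
exact.
Qed.

Lemma has_sumZ f s c : has_sum f s -> has_sum (fun i => c * f i) (c * s).
Proof.
move=> [fs]; split.
rewrite (_ : summability.partial_sum _ =
  (fun A => c *: (summability.partial_sum f A : R[i]^o))); last first.
  by apply/funext => A; rewrite /summability.partial_sum /= -mulr_sumr.
have := @cvgZl_tmp _ R[i]^o _ _ (summability.totally_filter : Filter _) c _ _ fs.
exact.
Qed.

(** Partial sums of a non-negative family grow with the index set and stay below the supremum, so
    one finite set coming within [e] of it controls all larger ones. *)
Lemma has_sum_esum (f : G -> R) : (forall g, 0 <= f g) ->
  (\esum_(g in [set: G]) (f g)%:E < +oo)%E ->
  has_sum (fun g => (f g)%:C) (fine (\esum_(g in [set: G]) (f g)%:E))%:C.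
Proof.
move=> f0 foo; set S := (X in fine X).
have S0 : (0 <= S)%E by apply: esum_ge0 => g _; rewrite lee_fin.
have Sf : S \is a fin_num by rewrite ge0_fin_numE.
have partE (A : {fset G}) : summability.partial_sum (fun g => (f g)%:C) A =
   (\sum_(g <- A) f g)%:C.
  by rewrite /summability.partial_sum big_seq_fsetE /= rmorph_sum.
have part_le (A : {fset G}) : \sum_(g <- A) f g <= fine S.
  rewrite -lee_fin fineK //; apply: esum_ge; exists [set` A].
    by split => //; exact: finite_fset.
  by rewrite fsbig_finite //= set_fsetK sumEFin.
have tF : Filter (@summability.totally G) by exact: summability.totally_filter.
split; apply/(@cvgrPdist_lt _ R[i]^o) => eps eps0.
(* In the order of [R[i]] a positive element is real, so the estimate can be carried out in [R]. *)
have eE : eps = (complex.Re eps)%:C.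
  by move: eps0; rewrite ltcE /= => /andP[/eqP i0 _]; case: eps i0 => ? ? /= ->.
move: eps0; rewrite eE ltcR; move: (complex.Re eps) => e e0 {eE}.
have /ereal_sup_gt [_ [A [finA _] <-] ltA] : ((fine S - e)%:E < S)%E.
  by rewrite -[ltRHS]fineK // lte_fin ltrBlDr ltrDl.
exists (fset_set A) => // B /= AB.
rewrite partE -rmorphB /= -normcE_norm normcR ltcR ger0_norm ?subr_ge0 //.
rewrite ltrBlDr addrC -ltrBlDr; apply: (lt_le_trans (y := \sum_(g <- fset_set A) f g)).
  by rewrite -lte_fin -sumEFin -fsbig_finite.
exact: ler_fset_sum.
Qed.

Lemma has_sum_eq f g s : has_sum f s -> f =1 g -> has_sum g s.
Proof. by move=> fs /funext <-. Qed.

Lemma sqsum_ge0 (v : G -> R[i]) : (0 <= sqsum v)%E.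
Proof. by apply: esum_ge0 => g _; rewrite lee_fin sqr_ge0. Qed.

Lemma l2norm_ge0 x : 0 <= l2norm x.
Proof. exact: sqrtr_ge0. Qed.

Lemma l2norm_sqr x : l2norm x ^+ 2 = fine (sqsum (\val x)).
Proof. by rewrite sqr_sqrtr // fine_ge0 // sqsum_ge0. Qed.

Lemma has_sum_l2norm x :
  has_sum (fun g => \val x g * (\val x g)^cj) (l2norm x ^+ 2)%:C.
Proof.
apply: (@has_sum_eq (fun g => (normc (\val x g) ^+ 2)%:C)); last first.
  by move=> g; rewrite normc_sqr.
rewrite l2norm_sqr; apply: has_sum_esum => [g|]; first exact: sqr_ge0.
exact/square_summableP/(valP x).
Qed.

Lemma l2valD x y g : \val (x + y) g = \val x g + \val y g.
Proof. by []. Qed.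

Lemma l2valZ c x g : \val (c *: x) g = c * \val x g.
Proof. by []. Qed.

Let I : R[i] := Complex 0 1.

Let sqrI : I * I = -1.
Proof. apply/eqP; rewrite eq_complex /=; apply/andP; split; apply/eqP; ring. Qed.

Let conjI : I^cj = - I.
Proof. by apply/eqP; rewrite eq_complex /= oppr0 !eqxx. Qed.

(** Applied coordinate by coordinate, this reduces the convergence of the series of an inner product
    to that of four squared norms. *)
Lemma polarization (u v : R[i]) :
  4^-1 * ((u + v) * (u + v)^cj + -1 * ((u + -1 * v) * (u + -1 * v)^cj) +
   (I * ((u + I * v) * (u + I * v)^cj) +
    - I * ((u + - I * v) * (u + - I * v)^cj))) = u * v^cj.
Proof.
rewrite !(conjcD, conjcM, conjcN, conjc1, conjI).
move: sqrI (u^cj) (v^cj) => i2 u' v'.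
rewrite [X in _ * X](_ : _ = 4 * (u * v')) ?mulKf ?pnatr_eq0 //.
transitivity (2 * (u * v') + 2 * (v * u') + 2 * (I * I) * (v * u' - u * v')).
  by ring.
by rewrite i2; ring.
Qed.

(** The inner product written through norms only: it provides the sum of the series in [l2dot], and
    shows that norm equalities carry over to inner products. *)
Definition l2polar x y : R[i] :=
  4^-1 * ((l2norm (x + y) ^+ 2)%:C + -1 * (l2norm (x + -1 *: y) ^+ 2)%:C +
   (I * (l2norm (x + I *: y) ^+ 2)%:C +
    - I * (l2norm (x + - I *: y) ^+ 2)%:C)).

Lemma has_sum_l2polar x y :
  has_sum (fun g => \val x g * (\val y g)^cj) (l2polar x y).
Proof.
have h c := has_sum_l2norm (x + c *: y).
have := has_sumZ 4^-1 (has_sumD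
  (has_sumD (has_sum_l2norm (x + y)) (has_sumZ (-1) (h (-1))))
  (has_sumD (has_sumZ I (h I)) (has_sumZ (- I) (h (- I))))).
move=> /has_sum_eq; apply => g; exact: polarization.
Qed.

Lemma l2dot_unique x y s :
  has_sum (fun g => \val x g * (\val y g)^cj) s -> l2dot x y = s.
Proof. exact: has_sum_unique. Qed.

Lemma l2dotE x y : l2dot x y = l2polar x y.
Proof. exact/l2dot_unique/has_sum_l2polar. Qed.

Lemma has_sum_l2dot x y :
  has_sum (fun g => \val x g * (\val y g)^cj) (l2dot x y).
Proof. by rewrite l2dotE; exact: has_sum_l2polar. Qed.

Lemma l2dotxx x : l2dot x x = (l2norm x ^+ 2)%:C.
Proof. exact/l2dot_unique/has_sum_l2norm. Qed.

Lemma l2dotDl x y z : l2dot (x + y) z = l2dot x z + l2dot y z.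
Proof.
apply: l2dot_unique; apply: (has_sum_eq (has_sumD (has_sum_l2dot x z) (has_sum_l2dot y z))).
by move=> g; rewrite l2valD mulrDl.
Qed.

Lemma l2dotZl c x y : l2dot (c *: x) y = c * l2dot x y.
Proof.
apply: l2dot_unique; apply: (has_sum_eq (has_sumZ c (has_sum_l2dot x y))).
by move=> g; rewrite l2valZ mulrA.
Qed.

Lemma l2normZ c x : l2norm (c *: x) = normc c * l2norm x.
Proof.
apply: (@pexpIrn _ 2) => //; rewrite ?nnegrE ?mulr_ge0 ?normc_ge0 ?l2norm_ge0 //.
apply: complexI; transitivity (c * c^cj * l2dot x x); last first.
  by rewrite l2dotxx -normc_sqr -real_complexM exprMn.
rewrite -l2dotxx; apply: l2dot_unique.
apply: (has_sum_eq (has_sumZ (c * c^cj) (has_sum_l2dot x x))) => g.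
by rewrite l2valZ conjcM mulrACA.
Qed.

(** In the polarization formula, exchanging [x] and [y] keeps the first two norms and swaps the two
    with coefficients [I] and [- I]; conjugation has the same effect. *)
Lemma l2dotC x y : l2dot y x = (l2dot x y)^cj.
Proof.
have nN1 : normc (-1 : R[i]) = 1 by rewrite /= oppr0 expr0n addr0 sqrrN expr1n sqrtr1.
have nN (a b : l2 R G) : l2norm (a + -1 *: b) = l2norm (b + -1 *: a).
  transitivity (l2norm (-1 *: (b + -1 *: a))); last by rewrite (l2normZ (-1)) nN1 mul1r.
  by congr l2norm; rewrite scalerDr scalerA mulrNN mulr1 scale1r addrC.
have ni : normc I = 1 by rewrite /= expr0n expr1n add0r sqrtr1.
have nI (a b : l2 R G) : l2norm (a + I *: b) = l2norm (b + - I *: a).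
  transitivity (l2norm (I *: (b + - I *: a))); last by rewrite (l2normZ I) ni mul1r.
  by congr l2norm; rewrite scalerDr scalerA mulrN sqrI opprK scale1r addrC.
rewrite !l2dotE /l2polar !(conjcD, conjcM, conjcN, conjc1, conjI, conjc_real, opprK).
rewrite (nI y x) -(nI x y) (addrC y x) (nN y x) conjc_inv conjc_nat.
by rewrite [X in _ * (_ + X)]addrC.
Qed.

Lemma l2dotDr x y z : l2dot z (x + y) = l2dot z x + l2dot z y.
Proof. by rewrite l2dotC l2dotDl conjcD -!l2dotC. Qed.

Lemma l2dotZr c x y : l2dot x (c *: y) = c^cj * l2dot x y.
Proof. by rewrite l2dotC l2dotZl conjcM -l2dotC. Qed.

Lemma normc_le_l2norm x g : normc (\val x g) <= l2norm x.
Proof.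
rewrite -(ler_pXn2r (n := 2)) ?nnegrE ?normc_ge0 ?l2norm_ge0 //.
rewrite l2norm_sqr -lee_fin fineK; last first.
  by rewrite ge0_fin_numE ?sqsum_ge0 //; exact/square_summableP/(valP x).
apply: esum_ge; exists [set g]; first by split => //; exact: finite_set1.
by rewrite fsbig_set1.
Qed.

Lemma l2norm_eq0 x : l2norm x = 0 -> x = 0.
Proof.
move=> x0; apply/val_inj/funext => g /=; apply: ComplexField.Normc.eq0_normc.
by apply/eqP; rewrite -normr_le0 ger0_norm ?normc_ge0 // -x0 normc_le_l2norm.
Qed.

Lemma l2norm_cauchy_schwarz x y : normc (l2dot x y) <= l2norm x * l2norm y.
Proof.
have [y0|y0] := eqVneq (l2norm y) 0.
  have -> : y = 0 *: y by rewrite scale0r; exact: l2norm_eq0.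
  by rewrite l2dotZr conjc0 mul0r ComplexField.Normc.normc0 mulr_ge0 ?l2norm_ge0.
have [c cE] : exists c, c = l2dot x y by exists (l2dot x y).
have [b bE] : exists b, b = l2norm y ^+ 2 by exists (l2norm y ^+ 2).
have b0 : 0 < b by rewrite bE exprn_gt0 // lt_neqAle eq_sym y0 l2norm_ge0.
(* Up to the factor [b], this vector is the component of [x] orthogonal to [y]. *)
have : 0 <= l2norm (b%:C *: x + (- c) *: y) ^+ 2 by apply: sqr_ge0.
rewrite -ler0c -l2dotxx !(l2dotDl, l2dotDr, l2dotZl, l2dotZr) !l2dotxx (l2dotC x y) -cE -bE.
rewrite conjcN conjc_real.
rewrite (_ : _ + _ = (b * (b * l2norm x ^+ 2 - normc c ^+ 2))%:C); last first.
  by rewrite (real_complexM b) rmorphB /= (real_complexM b) normc_sqr; ring.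
rewrite ler0c pmulr_rge0 // subr_ge0 bE cE mulrC -exprMn => h.
by rewrite -(ler_pXn2r (n := 2)) // nnegrE ?mulr_ge0 ?normc_ge0 ?l2norm_ge0.
Qed.

Lemma l2norm_triangle x y : l2norm (x + y) <= l2norm x + l2norm y.
Proof.
rewrite -(ler_pXn2r (n := 2)) ?nnegrE ?addr_ge0 ?l2norm_ge0 //.
have : complex.Re (l2dot (x + y) (x + y)) <= complex.Re (((l2norm x + l2norm y) ^+ 2)%:C).
  rewrite l2dotDl !l2dotDr !l2dotxx (l2dotC x y).
  have := le_trans (Re_le_normc _) (l2norm_cauchy_schwarz x y).
  by case: (l2dot x y) => a b /= ab; nra.
by rewrite l2dotxx.
Qed.

End InnerProduct.

(** * Operators coming from the group ring *)

Section GroupRingOperators.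
Variables (R : realType) (G : groupType).
Implicit Types (x y z : l2 R G) (S T : l2 R G -> l2 R G) (c : R[i]) (g h : G).

Lemma linear_left_regular g : linear (@left_regular R G g).
Proof. by move=> a x y; apply/val_inj. Qed.

Lemma l2norm_left_regular g x : l2norm (left_regular g x) = l2norm x.
Proof.
rewrite /l2norm; congr (Num.sqrt (fine _)); rewrite /sqsum /=.
rewrite [RHS](reindex_esum [set: G] [set: G] (fun h => (g^-1 * h)%g)) //.
rewrite setTT_bijective.
by exists (fun h => (g * h)%g) => h; rewrite ?mulKg ?mulVKg.
Qed.

Lemma left_regularM g h x : left_regular (g * h)%g x = left_regular g (left_regular h x).
Proof. by apply/val_inj/funext => k /=; rewrite invgM mulgA. Qed.

Lemma left_regular1 x : left_regular 1%g x = x.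
Proof. by apply/val_inj/funext => k /=; rewrite invg1 mul1g. Qed.

Lemma left_regularZD g c x y :
  left_regular g (x + c *: y) = left_regular g x + c *: left_regular g y.
Proof. by apply/val_inj. Qed.

(** Translation by [g] is isometric with inverse the translation by [g^-1], so the norms in the two
    polarization formulas agree term by term. *)
Lemma adjoint_left_regular g : adjoint (@left_regular R G g) (left_regular g^-1%g).
Proof.
move=> x y; have nE c : l2norm (left_regular g x + c *: y) =
    l2norm (x + c *: left_regular g^-1%g y).
  rewrite -[in RHS](l2norm_left_regular g) left_regularZD -left_regularM.
  by rewrite mulgV left_regular1.
by rewrite !l2dotE /l2polar -!nE; have := nE 1; rewrite !scale1r => ->.
Qed.

Lemma l2norm0 : l2norm (0 : l2 R G) = 0.
Proof. by rewrite -(scale0r (0 : l2 R G)) l2normZ ComplexField.Normc.normc0 mul0r. Qed.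

(** A bound on the operator norm that avoids the supremum in [opnorm]. *)
Definition op_le T (M : R) : Prop := forall x, l2norm (T x) <= M * l2norm x.

(* A list of pairs stands for the element \sum_p p.1 p.2 of the group ring, so
   that an element has many representations. *)
Definition lam (f : seq (R[i] * G)) x : l2 R G :=
  \sum_(p <- f) p.1 *: left_regular p.2 x.

Definition fscale c (f : seq (R[i] * G)) := [seq (c * p.1, p.2) | p <- f].
Definition fstar (f : seq (R[i] * G)) := [seq (p.1^cj, p.2^-1%g) | p <- f].
Definition fmul (f k : seq (R[i] * G)) :=
  [seq (p.1 * q.1, (p.2 * q.2)%g) | p <- f, q <- k].

Definition ev (phi : G -> R) (f : seq (R[i] * G)) : R[i] :=
  \sum_(p <- f) p.1 * (phi p.2)%:C.

Implicit Types (f k : seq (R[i] * G)) (phi : G -> R).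

Lemma lam_cat f k x : lam (f ++ k) x = lam f x + lam k x.
Proof. exact: big_cat. Qed.

Lemma lam_fscale c f x : lam (fscale c f) x = c *: lam f x.
Proof.
by rewrite /lam big_map scaler_sumr; apply: eq_bigr => p _; rewrite scalerA.
Qed.

Lemma left_regular_sum (I : Type) (s : seq I) (F : I -> l2 R G) g :
  left_regular g (\sum_(i <- s) F i) = \sum_(i <- s) left_regular g (F i).
Proof.
elim/big_rec2: _ => [|i u v _ <-]; first by apply/val_inj.
by apply/val_inj.
Qed.

Lemma lam_fmul f k x : lam (fmul f k) x = lam f (lam k x).
Proof.
rewrite /lam big_allpairs_dep; apply: eq_bigr => p _.
rewrite left_regular_sum scaler_sumr; apply: eq_bigr => q _ /=.
rewrite left_regularM -scalerA; congr (_ *: _); exact/val_inj.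
Qed.

Lemma l2dot_suml (I : Type) (s : seq I) (F : I -> l2 R G) y :
  l2dot (\sum_(i <- s) F i) y = \sum_(i <- s) l2dot (F i) y.
Proof.
elim/big_rec2: _ => [|i u v _ <-]; last by rewrite l2dotDl.
by rewrite -(scale0r (0 : l2 R G)) l2dotZl mul0r.
Qed.

Lemma l2dot_sumr (I : Type) (s : seq I) (F : I -> l2 R G) y :
  l2dot y (\sum_(i <- s) F i) = \sum_(i <- s) l2dot y (F i).
Proof.
elim/big_rec2: _ => [|i u v _ <-]; last by rewrite l2dotDr.
by rewrite -(scale0r (0 : l2 R G)) l2dotZr conjc0 mul0r.
Qed.

Lemma adjoint_lam f : adjoint (lam f) (lam (fstar f)).
Proof.
move=> x y; rewrite /lam l2dot_suml big_map l2dot_sumr.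
apply: eq_bigr => p _ /=.
by rewrite l2dotZl l2dotZr conjcK adjoint_left_regular.
Qed.

Lemma adjoint_sub S S' T T' : adjoint T S -> adjoint T' S' ->
  adjoint (fun x => T x - T' x) (fun x => S x - S' x).
Proof.
move=> TS TS' x y; rewrite -(scaleN1r (T' x)) -(scaleN1r (S' y)) l2dotDl l2dotDr l2dotZl l2dotZr TS TS'.
by rewrite conjcN conjc1.
Qed.

(** Cauchy-Schwarz applied to [l2dot (T (S y)) y], which is the square of the norm of [S y]; one
    factor of that norm then cancels. *)
Lemma op_le_adjoint S T M : 0 <= M -> adjoint T S -> op_le T M -> op_le S M.
Proof.
move=> M0 TS TM y; have := l2norm_cauchy_schwarz (T (S y)) y.
rewrite TS l2dotxx normcR ger0_norm ?sqr_ge0 // => h.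
have [->|Sy0] := eqVneq (l2norm (S y)) 0; first by rewrite mulr_ge0 ?l2norm_ge0.
rewrite -(ler_pM2l (x := l2norm (S y))) ?lt_neqAle ?[0 == _]eq_sym ?Sy0 ?l2norm_ge0 //.
rewrite -expr2; apply: (le_trans h); rewrite mulrA [_ * M]mulrC.
by apply: ler_wpM2r; rewrite ?l2norm_ge0.
Qed.

Lemma l2dot_eq0 x : (forall y, l2dot y x = 0) -> x = 0.
Proof.
move=> /(_ x); rewrite l2dotxx => /complexI/eqP; rewrite sqrf_eq0 => /eqP.
exact: l2norm_eq0.
Qed.

(** [Cstar_adjoint] assumes nothing about the adjoint beyond the adjunction itself, so its linearity
    is extracted from the nondegeneracy of the inner product. *)
Lemma linear_adjoint S T : adjoint T S -> linear S.
Proof.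
move=> TS a x y; apply/eqP; rewrite -subr_eq0; apply/eqP/l2dot_eq0 => z.
rewrite -scaleN1r !(l2dotDr, l2dotZr) -!TS !(l2dotDr, l2dotZr) conjcN conjc1.
by rewrite mulN1r subrr.
Qed.

Lemma linear_opB T : linear T -> forall x y, T (x - y) = T x - T y.
Proof. by move=> lT x y; rewrite -scaleN1r addrC lT scaleN1r addrC. Qed.

Lemma bounded_op_le T : bounded_operator T -> exists2 M, 0 <= M & op_le T M.
Proof.
move=> [_ [M TM]]; exists `|M| => // x; apply: (le_trans (TM x)).
by apply: ler_wpM2r; rewrite ?l2norm_ge0 ?ler_norm.
Qed.

Lemma l2normN x : l2norm (- x) = l2norm x.
Proof.
rewrite -scaleN1r l2normZ.
have -> : normc (-1 : R[i]) = 1 by rewrite /= oppr0 expr0n addr0 sqrrN expr1n sqrtr1.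
by rewrite mul1r.
Qed.

Lemma l2norm_op_norm T x : bounded_operator T -> l2norm (T x) <= opnorm T * l2norm x.
Proof.
move=> bT; have [M M0 TM] := bounded_op_le bT.
have [x0|x0] := eqVneq (l2norm x) 0.
  by have := TM x; rewrite x0 !mulr0.
have xp : 0 < l2norm x by rewrite lt_neqAle eq_sym x0 l2norm_ge0.
have [u u1 xE] : exists2 u, l2norm u = 1 & x = (l2norm x)%:C *: u.
  exists ((l2norm x)^-1%:C *: x).
    by rewrite l2normZ normcR gtr0_norm ?invr_gt0 // mulVf.
  by rewrite scalerA -real_complexM mulfV //; exact/esym/scale1r.
have lT0 c v : T (c *: v) = c *: T v.
  case: bT => lT _; have T0 : T 0 = 0.
    by have := linear_opB lT 0 0; rewrite !subrr.
  by rewrite -[c *: v]addr0 lT T0 addr0.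
rewrite {1}xE lT0 l2normZ normcR gtr0_norm // mulrC ler_wpM2r ?l2norm_ge0 //.
apply: ub_le_sup; last by exists u => //=; rewrite u1.
exists M => _ [v /= v1 <-]; apply: (le_trans (TM v)).
by rewrite -[leRHS]mulr1 ler_wpM2l.
Qed.

Definition approx T f (e : R) : Prop := op_le (fun x => T x - lam f x) e.

(** The norm closure of the group ring among the bounded operators. By minimality [reduced_Cstar]
    lies in it, so elements of [reduced_Cstar] can be approximated by group ring elements. *)
Definition lam_closure : set (l2 R G -> l2 R G) :=
  [set T | bounded_operator T /\ forall e, 0 < e -> exists f, approx T f e].

Lemma approxD S T f k d e : approx S f d -> approx T k e ->
  approx (S + T) (f ++ k) (d + e).
Proof.
move=> Sf Tk x; rewrite lam_cat mulrDl.
rewrite (_ : _ - _ = (S x - lam f x) + (T x - lam k x)); last first.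
  by rewrite opprD addrACA.
exact: le_trans (l2norm_triangle _ _) (lerD (Sf x) (Tk x)).
Qed.

Lemma approxZ T f c e : approx T f e -> approx (c *: T) (fscale c f) (normc c * e).
Proof.
move=> Tf x; rewrite lam_fscale.
rewrite (_ : _ - _ = c *: (T x - lam f x)); last by rewrite scalerBr.
rewrite l2normZ -mulrA.
by rewrite ler_wpM2l ?normc_ge0.
Qed.

Lemma approx_op_le T f e M : op_le T M -> approx T f e -> op_le (lam f) (M + e).
Proof.
move=> TM Tf x; rewrite mulrDl -[lam f x](subrK (T x)) addrC.
apply: le_trans (l2norm_triangle _ _) (lerD (TM x) _).
by rewrite -opprB l2normN.
Qed.

(** The error splits as [S (T - lam k) + (S - lam f) (lam k)], and [lam k] has norm at most
    [N + e]. *)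
Lemma approxM S T f k d e M N : linear S -> op_le S M -> op_le T N ->
  0 <= M -> 0 <= d ->
  approx S f d -> approx T k e -> approx (S \o T) (fmul f k) (M * e + d * (N + e)).
Proof.
move=> lS SM TN M0 d0 Sf Tk x; rewrite lam_fmul /= mulrDl.
rewrite (_ : _ - _ = S (T x - lam k x) + (S (lam k x) - lam f (lam k x))); last first.
  by rewrite (linear_opB lS) addrA subrK.
apply: le_trans (l2norm_triangle _ _) (lerD _ _).
  by apply: (le_trans (SM _)); rewrite -mulrA ler_wpM2l.
by apply: (le_trans (Sf _)); rewrite -mulrA ler_wpM2l // (approx_op_le TN Tk).
Qed.

Lemma approx_adjoint S T f e : 0 <= e -> adjoint T S -> approx T f e ->
  approx S (fstar f) e.
Proof.
move=> e0 TS; apply: op_le_adjoint e0 _.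
exact: adjoint_sub TS (adjoint_lam f).
Qed.

Lemma lam_closure_left_regular g : lam_closure (@left_regular R G g).
Proof.
split.
  split; first exact: linear_left_regular.
  by exists 1 => x; rewrite l2norm_left_regular mul1r.
move=> e e0; exists [:: (1, g)] => x; rewrite /lam big_seq1 scale1r subrr l2norm0.
by rewrite mulr_ge0 ?l2norm_ge0 // ltW.
Qed.

Lemma bounded_operator_comb S T c : bounded_operator S -> bounded_operator T ->
  bounded_operator (c *: S + T).
Proof.
move=> bS bT; have [M M0 SM] := bounded_op_le bS; have [N N0 TN] := bounded_op_le bT.
split=> [a x y|].
  have -> : (c *: S + T) (a *: x + y) = c *: S (a *: x + y) + T (a *: x + y) by [].
  rewrite bS.1 bT.1 !scalerDr !scalerA addrACA (mulrC c) -!scalerA -scalerDr.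
  by [].
exists (normc c * M + N) => x; rewrite mulrDl -mulrA.
apply: le_trans (l2norm_triangle _ _) (lerD _ _) => //.
by rewrite l2normZ ler_wpM2l ?normc_ge0.
Qed.

Lemma Cstar_lam_closure : Cstar_subalgebra lam_closure.
Proof.
have b0 : bounded_operator (0 : l2 R G -> l2 R G).
  split=> [a x y|]; first by rewrite /= scaler0 addr0.
  by exists 0 => x; rewrite mul0r (l2norm0 : l2norm ((0 : l2 R G -> l2 R G) x) = 0).
have fsum0 T : T + 0 = T by exact: addr0.
split.
- by move=> T [].
- split=> // e e0; exists [::] => x; rewrite /lam big_nil subr0 /=.
  rewrite (l2norm0 : l2norm ((0 : l2 R G -> l2 R G) x) = 0).
  by rewrite mulr_ge0 ?l2norm_ge0 ?ltW.
- move=> S T [bS aS] [bT aT]; split.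
    by have := bounded_operator_comb 1 bS bT; rewrite scale1r.
  move=> e e0; have e2 : 0 < e / 2 by rewrite divr_gt0.
  have [f Sf] := aS _ e2; have [k Tk] := aT _ e2.
  by exists (f ++ k); rewrite [e]splitr; exact: approxD.
- move=> c T [bT aT]; split.
    by have := bounded_operator_comb c bT b0; rewrite fsum0.
  move=> e e0; have c0 : 0 < normc c + 1 by rewrite ltr_wpDl ?normc_ge0.
  have [f Tf] := aT (e / (normc c + 1)) (divr_gt0 e0 c0).
  exists (fscale c f) => x; apply: (le_trans (approxZ c Tf x)).
  rewrite ler_wpM2r ?l2norm_ge0 // mulrCA ler_piMr ?(ltW e0) //.
  by rewrite ler_pdivrMr // mul1r lerDl.
- move=> S T [bS aS] [bT aT].
  have [M M0 SM] := bounded_op_le bS; have [N N0 TN] := bounded_op_le bT.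
  split.
    split=> [a x y|]; first by rewrite /= bT.1 bS.1.
    exists (M * N) => x; apply: (le_trans (SM _)).
    by rewrite -mulrA ler_wpM2l.
  move=> e e0; have M1 : 0 < M + 1 by rewrite ltr_wpDl.
  (* The tolerances [d] for [T] and [e / 2 / (N + d)] for [S] make each of the two terms in
     [approxM] at most [e / 2]. *)
  pose d := e / 2 / (M + 1); have d0 : 0 < d by rewrite !divr_gt0.
  have [k Tk] := aT _ d0; have Nd : 0 < N + d by rewrite ltr_wpDl.
  have [f Sf] := aS (e / 2 / (N + d)) (divr_gt0 (divr_gt0 e0 (ltr0Sn R 1)) Nd).
  exists (fmul f k) => x.
  have d'0 : 0 <= e / 2 / (N + d) by rewrite !divr_ge0 // ltW.
  apply: (le_trans (approxM bS.1 SM TN M0 d'0 Sf Tk x)).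
  rewrite ler_wpM2r ?l2norm_ge0 // [leRHS]splitr lerD //.
    by rewrite /d mulrCA ler_piMr ?divr_ge0 ?(ltW e0) // ler_pdivrMr // mul1r lerDl.
  by rewrite divfK // gt_eqF.
- move=> T S [bT aT] TS; have [M M0 TM] := bounded_op_le bT.
  split; first by split; [exact: linear_adjoint TS | exists M; exact: op_le_adjoint TS TM].
  move=> e e0; have [f Tf] := aT e e0; exists (fstar f).
  exact: approx_adjoint (ltW e0) TS Tf.
- move=> u T au bT uT; split=> // e e0; have e2 : 0 < e / 2 by rewrite divr_gt0.
  have /cvgrPdist_lt/(_ _ e2) [n _ /(_ n (leqnn n))] := uT.
  rewrite sub0r normrN => /(le_lt_trans (ler_norm _)) ne.
  have [bu /(_ _ e2) [f uf]] := au n; exists f => x.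
  have bd : bounded_operator (u n - T).
    have := bounded_operator_comb (-1) bT bu.
    by rewrite (_ : _ + _ = u n - T) // addrC scaleN1r.
  rewrite -[T x](subrK (u n x)) -addrA [e]splitr mulrDl.
  apply: le_trans (l2norm_triangle _ _) (lerD _ (uf x)).
  rewrite -opprB l2normN; apply: (le_trans (l2norm_op_norm x bd)).
  by rewrite ler_wpM2r ?l2norm_ge0 ?(ltW ne).
Qed.

Lemma reduced_Cstar_closure T : reduced_Cstar T -> lam_closure T.
Proof.
apply; split; first exact: Cstar_lam_closure.
by move=> _ [g _ <-]; exact: lam_closure_left_regular.
Qed.

Lemma reduced_Cstar_left_regular g : @reduced_Cstar R G (left_regular g).
Proof. by move=> A [_]; apply; exists g. Qed.

End GroupRingOperators.

(** * Tempered functions and their traces *)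

Section ComplexParts.
Variable R : realType.

Lemma Im_le_normc (z : R[i]) : complex.Im z <= normc z.
Proof.
have -> : complex.Im z = complex.Re (z * Complex 0 (-1)) by case: z => a b /=; ring.
apply: (le_trans (Re_le_normc _)); rewrite normcM.
by rewrite /= expr0n add0r sqrrN expr1n sqrtr1 mulr1.
Qed.

Lemma normc_le_Re_Im (z : R[i]) : normc z <= `|complex.Re z| + `|complex.Im z|.
Proof.
rewrite -(ler_pXn2r (n := 2)) ?nnegrE ?normc_ge0 ?addr_ge0 //.
case: z => a b /=; rewrite sqr_sqrtr ?addr_ge0 ?sqr_ge0 //.
rewrite -(real_normK (num_real a)) -(real_normK (num_real b)).
have : 0 <= `|a| * `|b| by rewrite mulr_ge0.
by rewrite sqrrD; lra.
Qed.

Lemma ReB (z w : R[i]) : complex.Re (z - w) = complex.Re z - complex.Re w.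
Proof. by case: z; case: w. Qed.

Lemma ImB (z w : R[i]) : complex.Im (z - w) = complex.Im z - complex.Im w.
Proof. by case: z; case: w. Qed.

(** The half-line of non-negative reals is closed in the plane: the vanishing of the imaginary part
    and the sign of the real part both pass to the limit. *)
Lemma complex_ge0_lim (z : R[i]) :
  (forall e : R, 0 < e -> exists2 w : R[i], 0 <= w & normc (z - w) <= e) -> 0 <= z.
Proof.
move=> h.
have im0 : complex.Im z = 0.
  apply/eqP; rewrite -normr_le0; apply/ler_addgt0Pr => e e0; rewrite add0r.
  have [w w0 zw] := h e e0; move: w0; rewrite lecE => /andP[/eqP w0 _].
  have := Im_le_normc (w - z); have := Im_le_normc (z - w).
  by rewrite [normc (w - z)]normcB !ImB w0 ler_norml /= => ? ?; apply/andP; split; lra.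
have re0 : 0 <= complex.Re z.
  rewrite -oppr_le0; apply/ler_addgt0Pr => e e0; rewrite add0r.
  have [w w0 zw] := h e e0; move: w0; rewrite lecE => /andP[_ /= w0].
  have := Re_le_normc (w - z); rewrite normcB ReB; lra.
by rewrite lecE im0 re0 eqxx.
Qed.

End ComplexParts.

Section RegularFunctions.
Variables (R : realType) (G : groupType).
Implicit Types (phi psi : G -> R) (f k : seq (R[i] * G)) (g h : G) (c : R[i]).
Implicit Types (S T : l2 R G -> l2 R G).

Lemma ev_cat phi f k : ev phi (f ++ k) = ev phi f + ev phi k.
Proof. exact: big_cat. Qed.

Lemma ev_fscale phi c f : ev phi (fscale c f) = c * ev phi f.
Proof.
by rewrite /ev big_map mulr_sumr; apply: eq_bigr => p _; rewrite mulrA.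
Qed.

Lemma ev_fmul phi f k : ev phi (fmul f k) =
  \sum_(p <- f) \sum_(q <- k) p.1 * q.1 * (phi (p.2 * q.2)%g)%:C.
Proof. by rewrite /ev big_allpairs_dep. Qed.

Lemma ev_fmulC phi f k : (forall g h, phi (g * h)%g = phi (h * g)%g) ->
  ev phi (fmul f k) = ev phi (fmul k f).
Proof.
move=> phiC; rewrite !ev_fmul exchange_big; apply: eq_bigr => q _.
by apply: eq_bigr => p _; rewrite phiC mulrC (mulrC p.1) mulrC.
Qed.

Lemma evD phi psi f : ev (fun g => phi g + psi g) f = ev phi f + ev psi f.
Proof.
by rewrite /ev -big_split; apply: eq_bigr => p _ /=; rewrite rmorphD mulrDr.
Qed.

Lemma evZ (r : R) phi f : ev (fun g => r * phi g) f = r%:C * ev phi f.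
Proof.
rewrite /ev mulr_sumr; apply: eq_bigr => p _ /=.
by rewrite real_complexM mulrCA.
Qed.

Lemma ev_fstar phi f : (forall g, phi g^-1%g = phi g) -> ev phi (fstar f) = (ev phi f)^cj.
Proof.
move=> phiV; rewrite /ev big_map; elim/big_rec2: _ => [|p u v _ ->].
  by rewrite conjc0.
by rewrite conjcD conjcM conjc_real phiV.
Qed.

Definition pos_def phi : Prop := forall f, 0 <= ev phi (fmul (fstar f) f).

(* The positive definite functions weakly contained in the regular
   representation. *)
Record tempered phi : Prop := {
  tempered_sym : forall g, phi g^-1%g = phi g ;
  tempered_pos : pos_def phi ;
  tempered_le : forall f (M : R), 0 <= M -> op_le (lam f) M ->
    normc (ev phi f) <= phi 1%g * M
}.

Section Trace.
Variable phi : G -> R.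
Hypothesis phi_tempered : tempered phi.
Hypothesis phi1 : phi 1%g = 1.
Hypothesis phiC : forall g h, phi (g * h)%g = phi (h * g)%g.

(* By contractivity the extension at [T] lies within [p.2] of [rho p.1], so it is
   the supremum of these lower bounds. *)
Definition extend (rho : seq (R[i] * G) -> R) T : R :=
  sup [set rho p.1 - p.2 | p in [set p | 0 <= p.2 /\ approx T p.1 p.2]].

(** Two approximations of [T] differ in operator norm by at most the sum of their errors. As [phi]
    is tempered and [phi 1 = 1], their values under [ev phi], hence under [rho], differ by no more,
    so each [rho k + d] is an upper bound of the set in [extend]. *)
Lemma extendP (rho : seq (R[i] * G) -> R) T f e :
  (forall f k, rho f - rho k <= normc (ev phi f - ev phi k)) ->
  0 <= e -> approx T f e -> `|extend rho T - rho f| <= e.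
Proof.
move=> rhoE e0 Tf; rewrite /extend; set A := (X in sup X).
have ubA k d : 0 <= d -> approx T k d -> ubound A (rho k + d).
  move=> d0 Tk _ [[k' d'] /= [d'0 Tk'] <-].
  rewrite /= lerBlDr -addrA -lerBlDl; apply: (le_trans (rhoE _ _)).
  have -> : ev phi k' - ev phi k = ev phi (k' ++ fscale (-1) k).
    by rewrite ev_cat ev_fscale mulN1r.
  have dd : 0 <= d + d' by rewrite addr_ge0.
  rewrite -[d + d']mul1r -phi1; apply: (tempered_le phi_tempered) => // x.
  rewrite lam_cat lam_fscale scaleN1r mulrDl.
  rewrite -[lam k' x](subrK (T x)) -addrA addrC.
  apply: le_trans (l2norm_triangle _ _) (lerD (Tk x) _).
  by rewrite -opprB l2normN.
have Af : A (rho f - e) by exists (f, e).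
rewrite ler_distl; apply/andP; split; last first.
  by apply: ge_sup; [exists (rho f - e) | exact: ubA].
by apply: ub_le_sup => //; exists (rho f + e); exact: ubA.
Qed.

(** Being a supremum, [extend] produces real numbers; hence the two parts are extended
    separately. *)
Definition tau T : R[i] :=
  Complex (extend (fun f => complex.Re (ev phi f)) T) (extend (fun f => complex.Im (ev phi f)) T).


Arguments tau : simpl never.

(** The factor [2] adds the errors of the real and the imaginary part. *)
Lemma tauP T f e : 0 <= e -> approx T f e -> normc (tau T - ev phi f) <= 2 * e.
Proof.
move=> e0 Tf.
have hR : `|extend (fun f => complex.Re (ev phi f)) T - complex.Re (ev phi f)| <= e.
  apply: (extendP _ e0 Tf) => k k' /=.
  by rewrite -ReB Re_le_normc.
have hI : `|extend (fun f => complex.Im (ev phi f)) T - complex.Im (ev phi f)| <= e.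
  apply: (extendP _ e0 Tf) => k k' /=.
  by rewrite -ImB Im_le_normc.
by apply: (le_trans (normc_le_Re_Im _)); rewrite mulr_natl mulr2n ReB ImB lerD.
Qed.

(** Identities for [tau] are checked on group ring approximations. The constant [C] absorbs the
    losses in sums and products, and [e <= 1] allows [e * e] to be replaced by [e]. *)
Lemma tau_eq T z (C : R) : 
  (forall e, 0 < e <= 1 -> exists2 f, approx T f (C * e) & normc (z - ev phi f) <= C * e) ->
  tau T = z.
Proof.
move=> h; apply/eqP; rewrite -subr_eq0; apply/eqP/ComplexField.Normc.eq0_normc.
apply/eqP; rewrite eq_le normc_ge0 andbT; apply/ler_addgt0Pr => e e0; rewrite add0r.
(* The [3] is the [2] of [tauP] plus the [1] of the assumed distance to [z]. *)
have C1 : 0 < 3 * (`|C| + 1) by rewrite mulr_gt0 // ltr_wpDl.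
pose d := Num.min 1 (e / (3 * (`|C| + 1))).
have d0 : 0 < d by rewrite lt_min ltr01 divr_gt0.
have [|f Tf zf] := h d; first by rewrite d0 ge_min lexx.
have Cd0 : 0 <= C * d by apply: le_trans zf; exact: normc_ge0.
have := tauP Cd0 Tf => tf.
rewrite -(subrK (ev phi f) (tau T)) -addrA.
apply: (le_trans (normcD _ _)); rewrite [normc (_ - z)]normcB.
apply: (le_trans (lerD tf zf)).
have : d <= e / (3 * (`|C| + 1)) by rewrite ge_min lexx orbT.
rewrite ler_pdivlMr // => de.
have : C * d <= `|C| * d by rewrite ler_wpM2r ?ler_norm // ltW.
lra.
Qed.

Lemma approx_le T f (d e : R) : d <= e -> approx T f d -> approx T f e.
Proof.
by move=> de Tf x; apply: (le_trans (Tf x)); rewrite ler_wpM2r ?l2norm_ge0.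
Qed.

Lemma tau_left_regular g : tau (left_regular g) = (phi g)%:C.
Proof.
apply: (@tau_eq _ _ 0) => e e0; exists [:: (1, g)] => [x|].
  by rewrite /lam big_seq1 scale1r subrr l2norm0 !mul0r.
by rewrite /ev big_seq1 mul1r subrr ComplexField.Normc.normc0 mul0r.
Qed.

Lemma tau_linear c S T : lam_closure S -> lam_closure T ->
  tau (c *: S + T) = c * tau S + tau T.
Proof.
move=> [bS aS] [bT aT]; apply: (@tau_eq _ _ (2 * normc c + 2)) => e /andP[e0 _].
have [f Sf] := aS e e0; have [k Tk] := aT e e0.
have c0 := normc_ge0 c.
have ce0 : 0 <= normc c * e by rewrite mulr_ge0 // ltW.
exists (fscale c f ++ k).
  apply: approx_le (approxD (approxZ c Sf) Tk); lra.
rewrite ev_cat ev_fscale opprD addrACA -mulrBr.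
apply: (le_trans (normcD _ _)); rewrite normcM.
rewrite mulrDl lerD ?(tauP (ltW e0) Tk) // [2 * normc c]mulrC -mulrA ler_wpM2l //.
exact: tauP (ltW e0) Sf.
Qed.

Lemma tau_comm S T : lam_closure S -> lam_closure T -> tau (S \o T) = tau (T \o S).
Proof.
move=> [bS aS] [bT aT].
have [M M0 SM] := bounded_op_le bS; have [N N0 TN] := bounded_op_le bT.
apply: (@tau_eq _ _ (2 * (M + N + 1))) => e /andP[e0 e1].
have [f Sf] := aS e e0; have [k Tk] := aT e e0.
have ee : e * e <= e by rewrite ler_piMr // ltW.
have Me : 0 <= M * e by rewrite mulr_ge0 // ltW.
have Ne : 0 <= N * e by rewrite mulr_ge0 // ltW.
exists (fmul f k).
  apply: approx_le (approxM bS.1 SM TN M0 (ltW e0) Sf Tk); lra.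
rewrite ev_fmulC //.
have h : approx (T \o S) (fmul k f) ((M + N + 1) * e).
  apply: approx_le (approxM bT.1 TN SM N0 (ltW e0) Tk Sf); lra.
apply: (le_trans (tauP _ h)); first by rewrite mulr_ge0 ?(ltW e0) ?addr_ge0.
by rewrite mulrA.
Qed.

Lemma tau_pos T S : lam_closure T -> adjoint T S -> 0 <= tau (S \o T).
Proof.
move=> [bT aT] TS; have [M M0 TM] := bounded_op_le bT.
have SM := op_le_adjoint M0 TS TM; have lS := linear_adjoint TS.
have D0 : 0 < 2 * (2 * M + 1) by rewrite mulr_gt0 // ltr_wpDl // mulr_ge0.
apply: complex_ge0_lim => r r0; pose e := Num.min 1 (r / (2 * (2 * M + 1))).
have e0 : 0 < e by rewrite lt_min ltr01 divr_gt0.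
have e1 : e <= 1 by rewrite ge_min lexx.
have er : e * (2 * (2 * M + 1)) <= r by rewrite -ler_pdivlMr // ge_min lexx orbT.
have [f Tf] := aT e e0; have Sf := approx_adjoint (ltW e0) TS Tf.
have ee : e * e <= e by rewrite ler_piMr // ltW.
have Me : 0 <= M * e by rewrite mulr_ge0 // ltW.
have h : approx (S \o T) (fmul (fstar f) f) ((2 * M + 1) * e).
  apply: approx_le (approxM lS SM TM M0 (ltW e0) Sf Tf); lra.
have h0 : 0 <= (2 * M + 1) * e by rewrite mulr_ge0 ?(ltW e0) ?addr_ge0 ?mulr_ge0.
exists (ev phi (fmul (fstar f) f)); first exact: tempered_pos.
by apply: (le_trans (tauP h0 h)); lra.
Qed.

Lemma tracial_state_tau : tracial_state (@reduced_Cstar R G) tau.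
Proof.
split.
- by move=> c S T /reduced_Cstar_closure AS /reduced_Cstar_closure AT; exact: tau_linear.
- by move=> T S /reduced_Cstar_closure AT; exact: tau_pos.
- rewrite (_ : idfun = left_regular 1%g); last by apply/funext => x; rewrite left_regular1.
  by rewrite tau_left_regular phi1.
- by move=> S T /reduced_Cstar_closure AS /reduced_Cstar_closure AT; exact: tau_comm.
Qed.

End Trace.

(** With [w = ev phi f], positivity at the group ring element [f - t * w] is a quadratic inequality
    in the real number [t]; its minimum, at the inverse of [phi 1], gives the claim. *)
Lemma pos_def_cauchy_schwarz phi f : (forall g, phi g^-1%g = phi g) -> pos_def phi ->
  normc (ev phi f) ^+ 2 <= phi 1%g * complex.Re (ev phi (fmul (fstar f) f)).
Proof.
move=> phiV phi_pos; set b := complex.Re _.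
have [w wE] : exists w, w = ev phi f by exists (ev phi f).
have [p pE] : exists p : R, p = normc w ^+ 2 by exists (normc w ^+ 2).
have p0 : 0 <= p by rewrite pE sqr_ge0.
have h (t : R) : 0 <= t * t * p * phi 1%g - (t * p + t * p) + b.
  pose s : R[i] := - t%:C * w; pose k := (s, 1%g) :: f.
  have e1 : ev phi (fmul (fstar f) f) = b%:C.
    by have := phi_pos f; rewrite lecE /b; case: (ev phi _) => x y /= /andP[/eqP ->].
  have e2 : ev phi (fmul (fstar k) k) =
      s^cj * s * (phi 1%g)%:C + (s^cj * w + (s * w^cj + b%:C)).
    rewrite /k ev_fmul /= !big_cons /= invg1 mulg1 -addrA; congr (_ + _).
    congr (_ + _).
      by rewrite wE /ev mulr_sumr; apply: eq_bigr => q _; rewrite mul1g mulrA.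
    under eq_bigr do rewrite big_cons.
    rewrite big_split /= -e1 ev_fmul; congr (_ + _).
    rewrite wE -(ev_fstar _ phiV) /ev mulr_sumr; apply: eq_bigr => q _.
    by rewrite mulg1 mulrA (mulrC s).
  have := phi_pos k; rewrite e2 (_ : _ + _ = (t * t * p * phi 1%g - (t * p + t * p) + b)%:C) ?ler0c //.
  have pC : p%:C = w * w^cj by rewrite pE normc_sqr.
  rewrite /s conjcM conjcN conjc_real !(rmorphD, rmorphN, rmorphM) /= pC.
  ring.
rewrite -wE -pE.
have f1 : 0 <= phi 1%g.
  have := phi_pos [:: (1, 1%g)]; rewrite /fstar /= ev_fmul !big_seq1 /= oppr0.
  by rewrite invg1 mulg1 !mul1r ler0c.
have [f0|fn0] := eqVneq (phi 1%g) 0.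
  rewrite f0 mul0r; have [//|] := leP p 0 => pp.
  (* Without its quadratic term the expression is affine in [t], and this [t] gives it the value
     [-1]. *)
  have := h ((b + 1) / (2 * p)); rewrite f0.
  rewrite (_ : _ + b = -1) ?ler0N1 //.
  field. by rewrite gt_eqF.
have := h (phi 1%g)^-1.
rewrite (_ : _ + b = b - p / phi 1%g); last by field.
rewrite subr_ge0 ler_pdivrMr 1?mulrC // lt_neqAle eq_sym fn0 //.
Qed.

End RegularFunctions.

(** * Finitely supported positive definite functions *)

Section PowerTrick.
Variable R : realType.

Lemma bernoulli_ineq (x : R) n : 0 <= x -> 1 + n%:R * x <= (1 + x) ^+ n.
Proof.
move=> x0; elim: n => [|n IHn]; first by rewrite mul0r addr0 expr0.
rewrite exprS; apply: (@le_trans _ _ ((1 + x) * (1 + n%:R * x))).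
  have : 0 <= n%:R * x * x by rewrite !mulr_ge0.
  rewrite -natr1; lra.
by rewrite ler_wpM2l // addr_ge0.
Qed.

(** When [p > 0], iterating the third hypothesis bounds the [2 ^ n]-th power of [a 0 / p] by
    [a n / p]. For [M > 0], the [2 ^ n]-th power of [a 0 / (p * M)] is then at most [K / p] for all
    [n], which a ratio above [1] would violate. *)
Lemma power_trick (a : nat -> R) (p K M : R) :
  0 <= p -> 0 <= M -> (forall n, 0 <= a n) ->
  (forall n, a n ^+ 2 <= p * a n.+1) ->
  (forall n, a n <= K * M ^+ (2 ^ n)) -> a 0 <= p * M.
Proof.
move=> p0 M0 a0 asq aK; rewrite leNgt; apply/negP => pM.
have pM0 : 0 <= p * M by rewrite mulr_ge0.
have a00 : 0 < a 0 by exact: le_lt_trans pM.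
have p_gt0 : 0 < p.
  rewrite lt_neqAle p0 andbT eq_sym; apply/eqP => pE.
  by have := asq 0; rewrite pE mul0r leNgt exprn_gt0.
have ind n : p * a 0 ^+ (2 ^ n) <= p ^+ (2 ^ n) * a n.
  elim: n => [|n IHn]; first by rewrite expn0 !expr1.
  have h : (p * a 0 ^+ (2 ^ n)) ^+ 2 <= (p ^+ (2 ^ n) * a n) ^+ 2.
    by rewrite ler_pXn2r // nnegrE mulr_ge0 ?exprn_ge0 // ltW.
  rewrite -(ler_pM2l p_gt0); apply: (@le_trans _ _ ((p * a 0 ^+ (2 ^ n)) ^+ 2)).
    by rewrite expnS mulnC exprM mulrA -expr2 exprMn.
  apply: (le_trans h); rewrite exprMn -exprM -[(2 ^ n * 2)%N]mulnC -expnS [leRHS]mulrCA.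
  by rewrite ler_wpM2l ?exprn_ge0.
have key n : p * a 0 ^+ (2 ^ n) <= K * (p * M) ^+ (2 ^ n).
  apply: (le_trans (ind n)); rewrite (exprMn _ p M) mulrCA.
  by apply: ler_wpM2l; rewrite ?exprn_ge0.
have [E|pMn0] := eqVneq (p * M) 0.
  by have := key 0; rewrite E expn0 !expr1 mulr0 leNgt mulr_gt0.
have pMp : 0 < p * M by rewrite lt_neqAle eq_sym pMn0.
pose x := a 0 / (p * M) - 1.
have x0 : 0 < x by rewrite subr_gt0 ltr_pdivlMr // mul1r.
(* The ratio is [1 + x]; Bernoulli's inequality and [n <= 2 ^ n] turn its powers into linear
   growth. *)
have bnd n : n%:R * (p * x) <= K.
  have aE : a 0 = (1 + x) * (p * M) by rewrite addrC subrK divfK.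
  have := key n; rewrite aE (exprMn _ (1 + x)) [in X in X -> _]mulrA ler_pM2r ?exprn_gt0 //.
  apply: le_trans; rewrite mulrCA ler_pM2l //.
  apply: le_trans (bernoulli_ineq (2 ^ n) (ltW x0)).
  apply: (@le_trans _ _ ((2 ^ n)%:R * x)); last by rewrite lerDr.
  by rewrite ler_wpM2r ?(ltW x0) // ler_nat ltnW // ltn_expl.
have px : 0 < p * x by rewrite mulr_gt0.
have := bnd (Num.trunc (`|K| / (p * x))).+1.
rewrite leNgt => /negP; apply; rewrite -ltr_pdivrMr //.
apply: le_lt_trans (truncnS_gt _); last first.
by rewrite ler_pM2r ?invr_gt0 // ler_norm.
Qed.

End PowerTrick.

(** * Stability properties and examples of tempered functions *)

Section TemperedFunctions.
Variables (R : realType) (G : groupType).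
Implicit Types (phi psi : G -> R) (f k : seq (R[i] * G)) (g h : G) (c : R[i]).

Lemma pos_def1 phi : pos_def phi -> 0 <= phi 1%g.
Proof.
move=> /(_ [:: (1, 1%g)]); rewrite /fstar /= ev_fmul !big_seq1 /= oppr0.
by rewrite invg1 mulg1 !mul1r ler0c.
Qed.

Definition delta_fun h : R[i] := (h == 1%g :> G)%:R.

Lemma square_summable_delta : delta_fun \in @square_summable R G.
Proof.
apply/square_summableP; rewrite /sqsum (_ : \esum_(_ in _) _ = 1%:E) ?ltry //.
transitivity (\esum_(g in [set (1%g : G)]) (1 : R)%:E); last first.
  by rewrite esum_set1 // lee_fin.
rewrite [RHS]esum_mkcond; apply: eq_esum => g _; rewrite /delta_fun.
have [->|g1] := eqVneq g 1%g.
  by rewrite mem_set // [normc _]ComplexField.Normc.normc1 expr1n.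
rewrite memNset; last by move=> /= /eqP; rewrite (negPf g1).
by rewrite [normc _]ComplexField.Normc.normc0 expr0n.
Qed.

(** The unit vector at the identity: [lam f] sends it to the coefficient function of [f], with
    repeated group elements collected. *)
Definition delta1 : l2 R G := Sub delta_fun square_summable_delta.

Lemma val_lam f (x : l2 R G) h :
  \val (lam f x) h = \sum_(p <- f) p.1 * \val x (p.2^-1 * h)%g.
Proof.
by rewrite /lam; elim: f => [|p f IHf]; rewrite ?big_nil // !big_cons l2valD IHf.
Qed.

(** Here [ev phi f] is a combination of finitely many coefficients of [lam f delta1], and each
    coefficient is at most the norm of that vector. *)
Lemma fin_supp_ev_le phi (S : seq G) : (forall g, g \notin S -> phi g = 0) ->
  exists K, forall f (M : R), op_le (lam f) M -> normc (ev phi f) <= K * M.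
Proof.
move=> phiS; pose D := undup S.
exists ((\sum_(h <- D) `|phi h|) * l2norm delta1) => f M fM.
have -> : ev phi f = \sum_(h <- D) (phi h)%:C * \val (lam f delta1) h.
  under eq_bigr do rewrite val_lam mulr_sumr.
  rewrite exchange_big; apply: eq_bigr => p _ /=; rewrite /delta_fun.
  have hE h : (p.2^-1 * h == 1)%g = (h == p.2).
    by rewrite -(inj_eq (mulgI p.2) (p.2^-1 * h)%g) mulVKg mulg1.
  have [pS|pS] := boolP (p.2 \in D).
    rewrite (bigD1_seq p.2) ?undup_uniq //= hE eqxx mulr1 mulrC big1 ?addr0 //.
    by move=> h /negPf hp; rewrite hE hp !mulr0.
  rewrite phiS ?mulr0; last by rewrite -mem_undup.
  rewrite big_seq big1 // => h hD; rewrite hE; case: eqP => [hp|_].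
    by rewrite -hp hD in pS.
  by rewrite !mulr0.
apply: (le_trans (normc_sum _ _)); rewrite -mulrA mulr_suml ler_sum // => h _.
rewrite normcM normcR ler_wpM2l //.
by apply: (le_trans (normc_le_l2norm _ _)); rewrite mulrC.
Qed.

Lemma tempered_fin_supp phi (S : seq G) : (forall g, phi g^-1%g = phi g) ->
  pos_def phi -> (forall g, g \notin S -> phi g = 0) -> tempered phi.
Proof.
move=> phiV phi_pos phiS; split=> // f M M0 fM.
have [K hK] := fin_supp_ev_le phiS.
(* Each passage from [f] to [f^* f] squares the norm bound, while Cauchy-Schwarz bounds the square
   of the old value by [phi 1] times the new one. *)
pose F := fix F n := if n is m.+1 then fmul (fstar (F m)) (F m) else f.
have FM n : op_le (lam (F n)) (M ^+ (2 ^ n)).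
  elim: n => [|n IHn] /=; first by rewrite expn0 expr1.
  move=> x; rewrite lam_fmul expnS mul2n -addnn exprD -mulrA.
  apply: le_trans (op_le_adjoint (exprn_ge0 _ M0) (adjoint_lam _) IHn _) _.
  by rewrite ler_wpM2l ?exprn_ge0.
apply: (power_trick (a := fun n => normc (ev phi (F n)))) (pos_def1 phi_pos) M0 _ _ _.
- by move=> n; exact: normc_ge0.
- move=> n; apply: (le_trans (pos_def_cauchy_schwarz _ phiV phi_pos)).
  by rewrite ler_wpM2l ?pos_def1 // Re_le_normc.
- by move=> n; exact: hK.
Qed.

Lemma temperedD phi psi : tempered phi -> tempered psi ->
  tempered (fun g => phi g + psi g).
Proof.
move=> [phiV phi0 phi_le] [psiV psi0 psi_le]; split.
- by move=> g; rewrite phiV psiV.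
- by move=> f; rewrite evD addr_ge0.
- move=> f M M0 fM; rewrite evD mulrDl.
  by apply: (le_trans (normcD _ _)); rewrite lerD ?phi_le ?psi_le.
Qed.

Lemma temperedZ (r : R) phi : 0 <= r -> tempered phi -> tempered (fun g => r * phi g).
Proof.
move=> r0 [phiV phi0 phi_le]; split.
- by move=> g; rewrite phiV.
- by move=> f; rewrite evZ mulr_ge0 // ler0c.
- move=> f M M0 fM; rewrite evZ normcM normcR ger0_norm // -mulrA.
  by rewrite ler_wpM2l ?phi_le.
Qed.

Lemma tempered0 : tempered (fun _ : G => 0 : R).
Proof.
have ev0 f : ev (fun _ : G => 0 : R) f = 0.
  by rewrite /ev big1 // => p _; rewrite mulr0.
split=> // [f|f M M0 fM]; first by rewrite ev0.
by rewrite ev0 mul0r ComplexField.Normc.normc0.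
Qed.

Lemma tempered_sum (I : Type) (s : seq I) (F : I -> G -> R) :
  (forall i, tempered (F i)) -> tempered (fun g => \sum_(i <- s) F i g).
Proof.
move=> hF; elim: s => [|i s IHs].
  by under eq_fun do rewrite big_nil; exact: tempered0.
under eq_fun do rewrite big_cons; exact: temperedD.
Qed.

Lemma ev_dist phi psi f (e : R) : (forall p, p \in f -> `|phi p.2 - psi p.2| <= e) ->
  normc (ev phi f - ev psi f) <= (\sum_(p <- f) normc p.1) * e.
Proof.
move=> fe; rewrite /ev -sumrB mulr_suml.
apply: (le_trans (normc_sum _ _)); rewrite big_seq [leRHS]big_seq.
apply: ler_sum => p pf; rewrite -mulrBr -rmorphB normcM normcR.
by rewrite ler_wpM2l ?normc_ge0 ?fe.
Qed.

(** For fixed [f], each condition in [tempered] involves only finitely many values of [phi], so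
    approximation on finite sets suffices. *)
Lemma tempered_lim phi :
  (forall (S : seq G) (e : R), 0 < e ->
    exists2 psi, tempered psi & forall g, g \in S -> `|phi g - psi g| <= e) ->
  tempered phi.
Proof.
move=> h; split.
- move=> g; apply/eqP; rewrite -subr_eq0 -normr_le0; apply/ler_addgt0Pr => e e0.
  rewrite add0r; have [psi tpsi /= hS] := h [:: g; g^-1%g] (e / 2) (divr_gt0 e0 (ltr0Sn R 1)).
  have := hS g; rewrite inE eqxx => /(_ isT) h1.
  have := hS g^-1%g; rewrite !inE eqxx orbT => /(_ isT); rewrite (tempered_sym tpsi) => h2.
  rewrite (_ : _ - _ = (phi g^-1%g - psi g) - (phi g - psi g)); last by ring.
  by apply: (le_trans (ler_normB _ _)); rewrite [e]splitr lerD.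
- move=> f; apply: complex_ge0_lim => e e0; set k := fmul _ _.
  pose C := \sum_(p <- k) normc p.1.
  have C0 : 0 < C + 1 by rewrite ltr_wpDl // sumr_ge0 // => p _; exact: normc_ge0.
  have [psi tpsi hS] := h [seq p.2 | p <- k] (e / (C + 1)) (divr_gt0 e0 C0).
  exists (ev psi k); first exact: tempered_pos.
  apply: (le_trans (ev_dist (fun p pk => hS _ (map_f _ pk)))).
  by rewrite -/C mulrCA ler_piMr ?(ltW e0) // ler_pdivrMr // mul1r lerDl.
- move=> f M M0 fM; apply/ler_addgt0Pr => e e0.
  pose C := \sum_(p <- f) normc p.1.
  (* [C] accounts for the change of [ev] at [f], [M] for the change of [phi 1] on the right-hand
     side. *)
  have C0 : 0 < C + M + 1.
    by rewrite ltr_wpDl // addr_ge0 // sumr_ge0 // => p _; exact: normc_ge0.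
  have [psi tpsi hS] := h (1%g :: [seq p.2 | p <- f]) (e / (C + M + 1)) (divr_gt0 e0 C0).
  have h1 : normc (ev phi f - ev psi f) <= C * (e / (C + M + 1)).
    by apply: ev_dist => p pf; rewrite hS // inE map_f ?orbT.
  have := hS 1%g; rewrite inE eqxx => /(_ isT) h2.
  have h3 := tempered_le tpsi M0 fM.
  rewrite -[ev phi f](subrK (ev psi f)); apply: (le_trans (normcD _ _)).
  apply: (le_trans (lerD h1 h3)).
  have h4 : psi 1%g <= phi 1%g + e / (C + M + 1).
    by move: h2; rewrite ler_norml => /andP[]; lra.
  have := ler_wpM2r M0 h4; rewrite mulrDl.
  have : (C + M + 1) * (e / (C + M + 1)) = e by rewrite mulrCA divff ?mulr1 // gt_eqF.
  have : 0 < e / (C + M + 1) by rewrite divr_gt0.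
  move: (e / (C + M + 1)) => d d0 dE.
  move: (psi 1%g * M) (phi 1%g * M) => u v.
  lra.
Qed.

(** For symmetric real [phi] the Hermitian form at [f] is the real form at the real parts plus that
    at the imaginary parts; the cross terms cancel by symmetry. *)
Lemma pos_def_real phi : (forall g, phi g^-1%g = phi g) ->
  (forall s : seq (R * G),
    0 <= \sum_(p <- s) \sum_(q <- s) p.1 * q.1 * phi (p.2^-1 * q.2)%g) ->
  pos_def phi.
Proof.
move=> phiV h f; rewrite ev_fmul big_map.
pose sR := [seq (complex.Re p.1, p.2) | p <- f].
pose sI := [seq (complex.Im p.1, p.2) | p <- f].
pose B (u v : R[i] * G -> R) :=
  \sum_(p <- f) \sum_(q <- f) u p * v q * phi (p.2^-1 * q.2)%g.
have BC u v : B u v = B v u.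
  rewrite /B exchange_big; apply: eq_bigr => p _; apply: eq_bigr => q _.
  by rewrite -[in LHS]phiV invgM invgK (mulrC (u q)).
pose re (p : R[i] * G) := complex.Re p.1; pose im (p : R[i] * G) := complex.Im p.1.
suff -> : \sum_(p <- f) \sum_(q <- f) (p.1^cj, p.2^-1%g).1 * q.1 *
     (phi ((p.1^cj, p.2^-1%g).2 * q.2)%g)%:C = (B re re + B im im)%:C.
  rewrite ler0c addr_ge0 //.
    by have := h sR; rewrite big_map; under eq_bigr do rewrite big_map.
  by have := h sI; rewrite big_map; under eq_bigr do rewrite big_map.
transitivity ((B re re + B im im) +i* (B re im - B im re)); last by rewrite BC subrr.
rewrite /B -!big_split -sumrB /=.
elim/big_rec3: _ => [//|p u v w _ ->].
rewrite -big_split -sumrB /=.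
have -> : \sum_(q <- f) p.1^cj * q.1 * (phi (p.2^-1 * q.2)%g)%:C =
  (\sum_(q <- f) (re p * re q * phi (p.2^-1 * q.2)%g + im p * im q * phi (p.2^-1 * q.2)%g)) +i*
  (\sum_(q <- f) (re p * im q * phi (p.2^-1 * q.2)%g - im p * re q * phi (p.2^-1 * q.2)%g)).
  elim/big_rec3: _ => [//|q u' v' w' _ ->].
  rewrite /re /im; case: (p.1) (q.1) => [a b] [a' b'] /=.
  by apply/eqP; rewrite eq_complex /=; apply/andP; split; apply/eqP; ring.
by apply/eqP; rewrite eq_complex /= !eqxx.
Qed.

Lemma tempered_indicator : tempered (fun g : G => (g == 1%g)%:R : R).
Proof.
apply: (@tempered_fin_supp _ [:: 1%g]).
- by move=> g; rewrite invg_eq1.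
- apply: pos_def_real => [g|s]; first by rewrite invg_eq1.
  pose S := undup [seq p.2 | p <- s].
  (* The form is the squared l2 norm of the collected coefficients. *)
  suff -> : \sum_(p <- s) \sum_(q <- s) p.1 * q.1 * ((p.2^-1 * q.2)%g == 1%g)%:R =
     \sum_(h <- S) (\sum_(p <- s) p.1 * (p.2 == h)%:R) ^+ 2.
    by apply: sumr_ge0 => h _; exact: sqr_ge0.
  under [RHS]eq_bigr do rewrite expr2 mulr_suml.
  rewrite [RHS]exchange_big /=; apply: eq_big_seq => p ps.
  under [RHS]eq_bigr do rewrite mulr_sumr.
  rewrite [RHS]exchange_big; apply: eq_bigr => q _ /=.
  have pS : p.2 \in S by rewrite mem_undup map_f.
  rewrite (bigD1_seq p.2) ?undup_uniq //= eqxx mulr1 big1 ?addr0.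
    by rewrite mulrA -(inj_eq (mulgI p.2) (p.2^-1 * q.2)%g) mulVKg mulg1 eq_sym.
  by move=> h hp; rewrite [p.2 == h]eq_sym (negPf hp) mulr0 mul0r.
- by move=> g; rewrite inE => /negPf ->.
Qed.

Lemma tempered_finite : finite_set [set: G] -> tempered (fun _ : G => 1 : R).
Proof.
move=> /finite_seqP[s sE]; apply: (@tempered_fin_supp _ s) => //.
- apply: pos_def_real => // t.
  rewrite (_ : \sum_(_ <- _) _ = (\sum_(p <- t) p.1) ^+ 2) ?sqr_ge0 //.
  rewrite expr2 mulr_suml; apply: eq_bigr => p _; rewrite mulr_sumr.
  by apply: eq_bigr => q _; rewrite mulr1.
- by move=> g; have : [set: G] g by []; rewrite sE /= => ->.
Qed.

(** The normalized [phi] and the indicator of [1] both extend to tracial states; uniqueness makes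
    them agree at [left_regular g]. *)
Lemma unique_trace_tempered phi g : unique_trace_property R G -> tempered phi ->
  0 < phi 1%g -> (forall g h, phi (g * h)%g = phi (h * g)%g) ->
  g != 1%g -> phi g = 0.
Proof.
move=> [tr0 _ uniq_tr] tphi phi1 phiC g1.
pose psi h := (phi 1%g)^-1 * phi h.
have tpsi : tempered psi by apply: temperedZ => //; rewrite invr_ge0 ltW.
have psi1 : psi 1%g = 1 by rewrite /psi mulVf // gt_eqF.
have psiC h (k : G) : psi (h * k)%g = psi (k * h)%g by rewrite /psi phiC.
pose d (h : G) : R := (h == 1%g)%:R.
have d1 : d 1%g = 1 by rewrite /d eqxx.
have dC h (k : G) : d (h * k)%g = d (k * h)%g.
  rewrite /d; congr (nat_of_bool _)%:R.
  rewrite -(inj_eq (mulgI h^-1%g) (h * k)%g) mulKg mulg1.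
  by rewrite -(inj_eq (mulIg h) k) mulVg.
have := uniq_tr _ (tracial_state_tau tpsi psi1 psiC) _ (@reduced_Cstar_left_regular R G g).
rewrite -(uniq_tr _ (tracial_state_tau tempered_indicator d1 dC) _ (@reduced_Cstar_left_regular R G g)).
rewrite (tau_left_regular tpsi psi1) (tau_left_regular tempered_indicator d1).
rewrite (negPf g1) => /complexI/eqP; rewrite mulf_eq0 invr_eq0 gt_eqF //=.
by move/eqP.
Qed.

End TemperedFunctions.

(** * Correlation functions of measure preserving actions *)

Section RealProbability.
Context d (T : measurableType d) (R : realType) (P : probability T R).
Implicit Types A B C : set T.

Definition pr A : R := fine (P A).

Lemma prE A : measurable A -> (pr A)%:E = P A.
Proof. by move=> mA; rewrite fineK // fin_num_measure. Qed.

Lemma pr_ge0 A : 0 <= pr A.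
Proof. exact: fine_ge0. Qed.

Lemma pr_le1 A : measurable A -> pr A <= 1.
Proof. by move=> mA; rewrite -lee_fin prE // probability_le1. Qed.

Lemma prT : pr setT = 1.
Proof. by rewrite /pr probability_setT. Qed.

Lemma pr0 : pr set0 = 0.
Proof. by rewrite /pr measure0. Qed.

Lemma pr_le A B : measurable A -> measurable B -> A `<=` B -> pr A <= pr B.
Proof.
by move=> mA mB AB; rewrite -lee_fin !prE // le_measure // inE.
Qed.

Lemma pr_split A B : measurable A -> measurable B ->
  pr A = pr (A `&` B) + pr (A `\` B).
Proof.
move=> mA mB; apply/EFin_inj; rewrite EFinD !prE //.
- by rewrite addeC; exact: measureDI.
- exact: measurableD.
- exact: measurableI.
Qed.

Lemma prU A B : measurable A -> measurable B -> pr (A `|` B) <= pr A + pr B.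
Proof.
move=> mA mB; rewrite -lee_fin EFinD !prE //; first exact: measureU2.
exact: measurableU.
Qed.

Lemma prC A : measurable A -> pr (~` A) = 1 - pr A.
Proof.
by move=> mA; rewrite -prT (pr_split measurableT mA) setTI setTD addrAC subrr add0r.
Qed.

Lemma pr_bigcup (F : nat -> set T) (e : R) : (forall n, measurable (F n)) ->
  nondecreasing_seq F -> 0 < e -> exists n, pr (\bigcup_k F k) <= pr (F n) + e.
Proof.
move=> mF ndF e0; have mU : measurable (\bigcup_k F k) by exact: bigcup_measurable.
have : P (F n) @[n --> \oo] --> (pr (\bigcup_k F k))%:E.
  by rewrite prE //; exact: (nondecreasing_cvg_mu (mu := P)).
move=> /fine_cvg /cvgrPdist_le/(_ _ e0)[n _ /(_ n (leqnn n)) /=].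
by move=> h; exists n; rewrite -lerBlDl; exact: le_trans (ler_norm _) h.
Qed.

Lemma pr_bigcap (F : nat -> set T) (e : R) : (forall n, measurable (F n)) ->
  nonincreasing_seq F -> 0 < e -> exists n, pr (F n) <= pr (\bigcap_k F k) + e.
Proof.
move=> mF niF e0; have mI : measurable (\bigcap_k F k) by exact: bigcap_measurableType.
have : P (F n) @[n --> \oo] --> (pr (\bigcap_k F k))%:E.
  rewrite prE //; apply: (nonincreasing_cvg_mu (mu := P)) => //.
  by apply: (le_lt_trans (probability_le1 P (mF 0))); rewrite ltry.
move=> /fine_cvg /cvgrPdist_le/(_ _ e0)[n _ /(_ n (leqnn n)) /=].
move=> h; exists n; rewrite -lerBlDl; apply: le_trans h.
by rewrite distrC ler_norm.
Qed.

(* The integral over [D] of the square of [c + \sum_(p <- s) p.1 * 1_(p.2)],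
   expanded; cutting [D] along the first set of [s] absorbs it into [c]. *)
Let square (s : seq (R * set T)) (c : R) D : R :=
  c ^+ 2 * pr D + 2 * c * \sum_(p <- s) p.1 * pr (D `&` p.2) +
  \sum_(p <- s) \sum_(q <- s) p.1 * q.1 * pr (D `&` (p.2 `&` q.2)).

Let square_ge0 s c D : (forall p, p \in [seq q.2 | q <- s] -> measurable p) -> measurable D ->
  0 <= square s c D.
Proof.
elim: s c D => [|[a A] s IHs] c D ms mD.
  by rewrite /square !big_nil mulr0 !addr0 mulr_ge0 ?sqr_ge0 ?pr_ge0.
have mA : measurable A by apply: ms; rewrite mem_head.
have {}ms p : p \in [seq q.2 | q <- s] -> measurable p.
  by move=> ps; apply: ms; rewrite inE ps orbT.
have ms' p : p \in s -> measurable p.2 by move=> ps; apply: ms; rewrite map_f.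
suff -> : square ((a, A) :: s) c D = square s (c + a) (D `&` A) + square s c (D `\` A).
  by rewrite addr_ge0 // IHs //; [exact: measurableI | exact: measurableD].
have split E : measurable E -> pr (D `&` E) = pr (D `&` A `&` E) + pr ((D `\` A) `&` E).
  move=> mE; rewrite (@pr_split (D `&` E) A) //; last exact: measurableI.
  by rewrite [D `&` E `&` A]setIAC -setIDA -setIDAC.
have e1 : \sum_(p <- s) p.1 * pr (D `&` p.2) =
    \sum_(p <- s) p.1 * pr (D `&` A `&` p.2) + \sum_(p <- s) p.1 * pr ((D `\` A) `&` p.2).
  rewrite -big_split; apply: eq_big_seq => p ps /=.
  by rewrite -mulrDr -split //; exact: ms'.
have e2 : \sum_(p <- s) \sum_(q <- s) p.1 * q.1 * pr (D `&` (p.2 `&` q.2)) =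
   \sum_(p <- s) \sum_(q <- s) p.1 * q.1 * pr (D `&` A `&` (p.2 `&` q.2)) +
   \sum_(p <- s) \sum_(q <- s) p.1 * q.1 * pr ((D `\` A) `&` (p.2 `&` q.2)).
  rewrite -big_split; apply: eq_big_seq => p ps /=.
  rewrite -big_split; apply: eq_big_seq => q qs /=.
  by rewrite -mulrDr -split //; apply: measurableI; exact: ms'.
rewrite /square !big_cons /= setIid e1.
under [X in _ + (_ + X) = _]eq_bigr do rewrite big_cons /=.
rewrite big_split /= e2 (pr_split mD mA).
have -> : \sum_(q <- s) a * q.1 * pr (D `&` (A `&` q.2)) =
    a * \sum_(q <- s) q.1 * pr (D `&` A `&` q.2).
  by rewrite mulr_sumr; apply: eq_bigr => q _; rewrite setIA mulrA.
have -> : \sum_(p <- s) p.1 * a * pr (D `&` (p.2 `&` A)) =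
    a * \sum_(q <- s) q.1 * pr (D `&` A `&` q.2).
  rewrite mulr_sumr; apply: eq_bigr => q _.
  by rewrite setIA setIAC (mulrC q.1) mulrA.
by ring.
Qed.

(** The double sum is the variance of [\sum_(p <- s) p.1 * 1_(p.2)], that is [square] with [c] equal
    to minus the mean. *)
Lemma pr_gram_ge0 (s : seq (R * set T)) :
  (forall p, p \in [seq q.2 | q <- s] -> measurable p) ->
  0 <= \sum_(p <- s) \sum_(q <- s) p.1 * q.1 * (pr (p.2 `&` q.2) - pr p.2 * pr q.2).
Proof.
move=> ms; pose c := \sum_(p <- s) p.1 * pr p.2.
have := square_ge0 (- c) ms measurableT.
rewrite /square prT (_ : \sum_(p <- s) p.1 * pr (setT `&` p.2) = c); last first.
  by apply: eq_bigr => p _; rewrite setTI.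
suff -> : \sum_(p <- s) \sum_(q <- s) p.1 * q.1 * (pr (p.2 `&` q.2) - pr p.2 * pr q.2) =
    (- c) ^+ 2 * 1 + 2 * - c * c +
    \sum_(p <- s) \sum_(q <- s) p.1 * q.1 * pr ([set: T] `&` (p.2 `&` q.2)) by [].
have cc : \sum_(p <- s) \sum_(q <- s) p.1 * q.1 * (pr p.2 * pr q.2) = c * c.
  rewrite {1}/c mulr_suml; apply: eq_bigr => p _.
  by rewrite /c mulr_sumr; apply: eq_bigr => q _; ring.
transitivity (\sum_(p <- s) \sum_(q <- s) p.1 * q.1 * pr (p.2 `&` q.2) - c * c).
  rewrite -cc -sumrB; apply: eq_bigr => p _; rewrite -sumrB.
  by apply: eq_bigr => q _; rewrite mulrBr.
under [in RHS]eq_bigr do under eq_bigr do rewrite setTI.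
by ring.
Qed.

End RealProbability.

Section ActionCorrelation.
Context (R : realType) (G : groupType).
Context d (X : measurableType d) (mu : probability X R) (a : G -> X -> X).
Hypothesis mp : mp_action mu a.

Lemma act1 x : a 1%g x = x.
Proof. by case: mp. Qed.

Lemma actM g h x : a (g * h)%g x = a g (a h x).
Proof. by case: mp. Qed.

Lemma actK g : cancel (a g) (a g^-1%g).
Proof. by move=> x; rewrite -actM mulVg act1. Qed.

Lemma actVK g : cancel (a g^-1%g) (a g).
Proof. by move=> x; rewrite -actM mulgV act1. Qed.

Lemma act_image g (A : set X) : a g @` A = a g^-1%g @^-1` A.
Proof.
apply/seteqP; split => [_ [x Ax <-]|x Ax] /=; first by rewrite actK.
by exists (a g^-1%g x) => //; rewrite actVK.
Qed.

Lemma measurable_act_preimage g (A : set X) : measurable A -> measurable (a g @^-1` A).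
Proof. by case: mp => _ _ ma _ mA; rewrite -[_ @^-1` _]setTI; exact: ma. Qed.

Lemma measurable_act g (A : set X) : measurable A -> measurable (a g @` A).
Proof. by move=> mA; rewrite act_image; exact: measurable_act_preimage. Qed.

Lemma pr_act_preimage g (A : set X) : measurable A -> pr mu (a g @^-1` A) = pr mu A.
Proof. by case: mp => _ _ _ ma mA; rewrite /pr ma. Qed.

Lemma pr_act g (A : set X) : measurable A -> pr mu (a g @` A) = pr mu A.
Proof. by move=> mA; rewrite act_image pr_act_preimage. Qed.

(** The matrix coefficient of the Koopman representation at the vector [1_A - mu(A)]. *)
Definition corr (A : set X) (g : G) : R :=
  pr mu ((a g @` A) `&` A) - pr mu A ^+ 2.

Lemma corrE A g h : measurable A ->
  corr A (g^-1 * h)%g = pr mu ((a g @` A) `&` (a h @` A)) - pr mu A ^+ 2.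
Proof.
move=> mA; rewrite /corr; congr (_ - _).
rewrite -[RHS](pr_act_preimage g); last by apply: measurableI; exact: measurable_act.
congr pr; rewrite setIC !act_image preimage_setI; congr (_ `&` _).
  by apply/seteqP; split=> x /=; rewrite actK.
by apply/seteqP; split=> x /=; rewrite invgM invgK actM.
Qed.

Lemma corr_sym A g : measurable A -> corr A g^-1%g = corr A g.
Proof.
move=> mA; rewrite -[g^-1%g]mulg1 corrE // /corr; congr (pr _ (_ `&` _) - _).
by apply/seteqP; split=> [_ [x Ax <-]|x Ax]; [rewrite act1|exists x; rewrite ?act1].
Qed.

Lemma corr_pos_def A : measurable A -> pos_def (corr A).
Proof.
move=> mA; apply: pos_def_real => [g|s]; first exact: corr_sym.
have := @pr_gram_ge0 _ _ _ mu [seq (p.1, a p.2 @` A) | p <- s].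
rewrite big_map /=; under eq_bigr do rewrite big_map /=.
rewrite (eq_bigr (fun p => \sum_(q <- s) p.1 * q.1 * corr A (p.2^-1 * q.2)%g)).
  by apply => _ /mapP[_ /mapP[p _ ->] ->]; exact: measurable_act.
move=> p _; apply: eq_bigr => q _.
by rewrite corrE // !pr_act // expr2.
Qed.

End ActionCorrelation.

(** * The Bernoulli shift *)

(** Both [x - y] and [b' ^+ 2 - b ^+ 2 = (b' - b) * (b' + b)] are at most [2 * e]. *)
Lemma sqr_close (R : realFieldType) (b b' x y e : R) : 0 <= b <= 1 -> 0 <= b' <= 1 ->
  0 <= e -> b' <= b + e -> x <= y + e + e -> x - b ^+ 2 - (y - b' ^+ 2) <= 4 * e.
Proof.
move=> /andP[b0 b1] /andP[b'0 b'1] e0 h1 h2.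
have h3 : 0 <= (b + e - b') * (b + b') by apply: mulr_ge0; lra.
have h4 : 0 <= e * (2 - b - b') by apply: mulr_ge0; lra.
by rewrite !expr2; lra.
Qed.

Section Bernoulli.
Variables (R : realType) (G : groupType) (P : probability (shift_space R G) R).
Hypothesis PE : product_lebesgue P.
Local Notation X := (shift_space R G).
Local Notation sh := (@bernoulli_shift R G).
Implicit Types (F : {fset G}) (A : G -> set (I01 R)) (B C : set X) (g h : G).

Definition cylinder F A : set X := [set f | forall g, g \in F -> A g (f g)].

Definition cylinders F : set (set X) :=
  [set cylinder F A | A in [set A | forall g, measurable (A g)]].

Let vol (A : set (I01 R)) : \bar R := lebesgue_measure ((fun x : I01 R => \val x) @` A).

Lemma P_cylinder F A : (forall g, measurable (A g)) ->
  P (cylinder F A) = (\prod_(g <- F) vol (A g))%E.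
Proof. by move=> mA; rewrite PE. Qed.

Lemma measurable_coordinate g (A : set (I01 R)) : measurable A ->
  measurable [set f : X | A (f g)].
Proof.
move=> mA; apply: sub_sigma_algebra; exists g => //; exists A => //.
by rewrite setTI.
Qed.

Lemma measurable_cylinder F A : (forall g, measurable (A g)) -> measurable (cylinder F A).
Proof.
move=> mA; rewrite (_ : cylinder F A = \bigcap_(g in [set` F]) [set f : X | A g (f g)]).
  by apply: fin_bigcap_measurable => // g _; exact: measurable_coordinate.
by [].
Qed.

Lemma cylinderI F A A' : cylinder F A `&` cylinder F A' = cylinder F (fun g => A g `&` A' g).
Proof.
by apply/seteqP; split=> [f [fA fA'] g gF|f fA]; [split; auto | split=> g /fA[]].
Qed.

Lemma setI_closed_cylinders F : setI_closed (cylinders F).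
Proof.
move=> _ _ [A mA <-] [A' mA' <-]; rewrite cylinderI.
by exists (fun g => A g `&` A' g) => // g; exact: measurableI.
Qed.

Lemma cylinder_subset F F' A : (F `<=` F')%fset ->
  cylinder F A = cylinder F' (fun g => if g \in F then A g else setT).
Proof.
move=> /fsubsetP FF'; apply/seteqP; split=> f fA g gF.
  by case: ifP => // gF'; exact: fA.
by have := fA g (FF' _ gF); rewrite gF.
Qed.

(** The events that depend only on the coordinates in [F]. *)
Definition local F : set (set X) := <<s cylinders F >>.

Lemma sigma_algebra_local F : sigma_algebra setT (local F).
Proof. exact: smallest_sigma_algebra. Qed.

Lemma measurable_local F B : local F B -> measurable B.
Proof.
move: B; apply: smallest_sub; first exact: sigma_algebra_measurable.
by move=> _ [A mA <-]; exact: measurable_cylinder.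
Qed.

Lemma local_subset F F' B : (F `<=` F')%fset -> local F B -> local F' B.
Proof.
move=> FF'; move: B; apply: smallest_sub; first exact: sigma_algebra_local.
move=> _ [A mA <-]; apply: sub_sigma_algebra.
rewrite (cylinder_subset _ FF'); eexists; last reflexivity.
by move=> g; case: ifP.
Qed.

Lemma measurable_cylindersE : measurable = <<s \bigcup_F cylinders F >> :> set (set X).
Proof.
apply/seteqP; split; apply: smallest_sub.
- exact: smallest_sigma_algebra.
- move=> _ [g _ [C mC <-]]; apply: sub_sigma_algebra.
  exists [fset g]%fset => //; exists (fun=> C) => //.
  by apply/seteqP; split=> f /=; [move=> /(_ g); rewrite inE eqxx; split=> //; auto | move=> [_ fC] h; rewrite inE => /eqP ->].
- exact: sigma_algebra_measurable.
- by move=> B [F _ [A mA <-]]; exact: measurable_cylinder.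
Qed.

Lemma setI_closed_all_cylinders : setI_closed (\bigcup_F cylinders F).
Proof.
move=> B B' [F _ [A mA <-]] [F' _ [A' mA' <-]].
rewrite (cylinder_subset _ (fsubsetUl F F')) (cylinder_subset _ (fsubsetUr F F')).
exists (F `|` F')%fset => //; apply: setI_closed_cylinders.
  by eexists; last reflexivity; move=> g; case: ifP.
by eexists; last reflexivity; move=> g; case: ifP.
Qed.

Lemma shift_preimage_cylinder g F A :
  sh g @^-1` cylinder F A = cylinder [fset (g^-1 * h)%g | h in F]%fset (fun h => A (g * h)%g).
Proof.
apply/seteqP; split=> f /= fA.
  by move=> _ /imfsetP[h hF ->]; have := fA h hF; rewrite mulVKg.
move=> h hF; have := fA (g^-1 * h)%g; rewrite mulVKg; apply.
by apply/imfsetP; exists h.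
Qed.

Lemma measurable_shift g : measurable_fun setT (sh g).
Proof.
apply: (measurability _ measurable_cylindersE) => _ [_ [F _ [A mA <-]] <-].
by rewrite setTI shift_preimage_cylinder; apply: measurable_cylinder.
Qed.

Lemma measurable_shift_preimage g B : measurable B -> measurable (sh g @^-1` B).
Proof. by move=> mB; rewrite -[_ @^-1` _]setTI; exact: measurable_shift. Qed.

(** By Dynkin's theorem it suffices to treat cylinders, where the shift only relabels the factors of
    the product. *)
Lemma shift_invariant g B : measurable B -> P (sh g @^-1` B) = P B.
Proof.
move=> mB; have : (<<s \bigcup_F cylinders F >>) B by rewrite -measurable_cylindersE.
move: B {mB}; apply: (dynkin_induction measurable_cylindersE setI_closed_all_cylinders).
- by rewrite preimage_setT.
- move=> _ [F _ [A mA <-]]; rewrite shift_preimage_cylinder !P_cylinder //.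
  rewrite big_imfset /=; last by move=> h k _ _ /mulgI.
  by apply: eq_bigr => h _; rewrite mulVKg.
- move=> B mB PB; rewrite preimage_setC !probability_setC //; first by rewrite PB.
  exact: measurable_shift_preimage.
- move=> F mF tF PF; rewrite preimage_bigcup.
  rewrite !measure_bigcup //; first by apply: eq_eseriesr => n _; exact: PF.
  + by move=> n _; exact: measurable_shift_preimage.
  + by apply/trivIsetP => i j _ _ ij; rewrite -preimage_setI (trivIsetP.1 tF) // preimage_set0.
Qed.

Lemma mp_bernoulli_shift : mp_action P sh.
Proof.
split.
- by move=> f; apply/funext => h; rewrite /bernoulli_shift invg1 mul1g.
- by move=> g h f; apply/funext => k; rewrite /bernoulli_shift invgM mulgA.
- exact: measurable_shift.
- exact: shift_invariant.
Qed.

(** The events independent of [C] form a lambda-system, so independence passes from a pi-system to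
    the sigma-algebra it generates. *)
Lemma independent_dynkin (S : set (set X)) C : setI_closed S -> S `<=` measurable ->
  measurable C -> (forall B, S B -> pr P (B `&` C) = pr P B * pr P C) ->
  forall B, <<s S >> B -> pr P (B `&` C) = pr P B * pr P C.
Proof.
move=> SI Sm mC SC B SB.
suff : [set B | measurable B /\ pr P (B `&` C) = pr P B * pr P C] B by case.
move: B SB; apply: lambda_system_subset => //; last by move=> B SB; split; [exact: Sm | exact: SC].
apply/dynkin_lambda_system; split.
- by split=> //; rewrite setTI prT mul1r.
- move=> B [mB BC]; split; first exact: measurableC.
  rewrite prC // mulrBl mul1r -BC (@pr_split _ _ _ P C B) //.
  by rewrite setIC -setDE [C `&` B]setIC addrAC subrr add0r.
- move=> F tF mF; have mF' n : measurable (F n) by case: (mF n).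
  split; first exact: bigcup_measurable.
  have mFC n : measurable (F n `&` C) by exact: measurableI.
  have mU : measurable (\bigcup_k F k) by exact: bigcup_measurable.
  apply/EFin_inj; rewrite EFinM !prE //; last exact: measurableI.
  rewrite setI_bigcupl !measure_bigcup //; last first.
    by apply/trivIsetP => i j _ _ ij; rewrite setIACA setIid (trivIsetP.1 tF) // set0I.
  rewrite muleC -(prE P mC) -nneseriesZl => [|n _]; last exact: measure_ge0.
  apply: eq_eseriesr => n _; have [_ FC] := mF n.
  transitivity (pr P (F n `&` C))%:E; first by rewrite prE.
  by rewrite FC EFinM muleC; congr (_ * _)%E; exact: prE.
Qed.

Lemma pr_cylinderI F F' A A' : [disjoint F & F']%fset ->
  (forall g, measurable (A g)) -> (forall g, measurable (A' g)) ->
  pr P (cylinder F A `&` cylinder F' A') = pr P (cylinder F A) * pr P (cylinder F' A').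
Proof.
move=> FF' mA mA'; pose A'' g := if g \in F then A g else A' g.
have notF g : g \in F' -> (g \in F) = false.
  by move=> gF'; apply/negbTE/negP => gF; move/fdisjointP: FF' => /(_ g gF); rewrite gF'.
have -> : cylinder F A `&` cylinder F' A' = cylinder (F `|` F')%fset A''.
  apply/seteqP; split=> [f [fA fA'] g|f fA].
    rewrite inE /A'' => /orP[gF|gF']; first by rewrite gF; exact: fA.
    by rewrite notF //; exact: fA'.
  split=> g gF; have := fA g; rewrite inE gF ?orbT /A'' => /(_ isT); first by rewrite gF.
  by rewrite notF.
apply/EFin_inj; rewrite EFinM !prE; try exact: measurable_cylinder; last first.
  by apply: measurable_cylinder => g; rewrite /A''; case: ifP.
rewrite !P_cylinder //; last by move=> g; rewrite /A''; case: ifP.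
rewrite (perm_big (F ++ F')) /=; last first.
  apply: uniq_perm => [||g]; rewrite ?fset_uniq //; last by rewrite inE mem_cat.
  rewrite cat_uniq !fset_uniq andbT /=; apply/hasPn => g gF' /=.
  by rewrite notF.
rewrite big_cat /=; congr (_ * _)%E; apply: eq_big_seq => g gF; rewrite /A''.
  by rewrite gF.
by rewrite notF.
Qed.

(** Dynkin's argument is used once in each variable, which leaves two cylinders over disjoint sets
    of coordinates. *)
Lemma pr_localI F F' B B' : [disjoint F & F']%fset -> local F B -> local F' B' ->
  pr P (B `&` B') = pr P B * pr P B'.
Proof.
move=> FF' FB F'B'.
have cm E : cylinders E `<=` measurable by move=> _ [A mA <-]; exact: measurable_cylinder.
apply: (independent_dynkin (@setI_closed_cylinders F) (cm F) (measurable_local F'B') _ FB).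
move=> _ [A mA <-]; rewrite setIC mulrC.
apply: (independent_dynkin (@setI_closed_cylinders F') (cm F') _ _ F'B').
  exact: measurable_cylinder.
by move=> _ [A' mA' <-]; rewrite setIC pr_cylinderI // mulrC.
Qed.

Lemma local_shift g F B : local F B -> local [fset (g * h)%g | h in F]%fset (sh g @` B).
Proof.
rewrite (act_image mp_bernoulli_shift).
suff : local F `<=` [set B | local [fset (g * h)%g | h in F]%fset (sh g^-1%g @^-1` B)] by apply.
have [s0 sC sU] := sigma_algebra_local [fset (g * h)%g | h in F]%fset.
apply: smallest_sub.
  split=> [|A /= /sC|A sA] /=.
  - by rewrite preimage_set0.
  - by rewrite !setTD preimage_setC.
  - by rewrite preimage_bigcup; exact: sU.
move=> _ [A mA <-]; apply: sub_sigma_algebra.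
rewrite shift_preimage_cylinder invgK; eexists; last reflexivity.
by move=> h; exact: mA.
Qed.

Lemma tempered_corr_local F B : local F B -> tempered (corr P sh B).
Proof.
move=> FB; have mB := measurable_local FB.
(* For [g] outside this list [gF] and [F] are disjoint, so [gB] and [B] are independent and the
   correlation is [0]. *)
apply: (@tempered_fin_supp _ _ _ [seq (h * k^-1)%g | h <- F, k <- F]).
- by move=> g; rewrite corr_sym //; exact: mp_bernoulli_shift.
- by apply: corr_pos_def => //; exact: mp_bernoulli_shift.
move=> g gF; rewrite /corr (pr_localI _ (@local_shift g F B FB) FB).
  by rewrite (pr_act mp_bernoulli_shift) // expr2 subrr.
apply/fdisjointP => _ /imfsetP[k kF ->]; apply/negP => gkF.
move/negP: gF; apply; apply/allpairsP; exists ((g * k)%g, k); split=> //=.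
by rewrite mulgK.
Qed.

Definition approximates (e : R) B B' := pr P (B `\` B') <= e /\ pr P (B' `\` B) <= e.

(** The sets that local sets approximate to any precision form a sigma-algebra containing the
    cylinders. *)
Lemma local_approx B (e : R) : measurable B -> 0 < e ->
  exists F B', local F B' /\ approximates e B B'.
Proof.
move=> mB0 e0; move: B e mB0 e0.
pose S : set (set X) := [set B | measurable B /\
  forall e, 0 < e -> exists F B', local F B' /\ approximates e B B'].
suff SB : measurable `<=` S by move=> B e /SB[_]; apply.
have SC B : S B -> S (~` B).
  move=> [mB aB]; split; first exact: measurableC.
  move=> e e0; have [F [B' [FB' [h1 h2]]]] := aB e e0.
  exists F, (~` B'); split; last by rewrite /approximates !setDE !setCK ![~` _ `&` _]setIC -!setDE.
  by rewrite -setTD; case: (sigma_algebra_local F) => _ sC _; exact: sC.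
have S0 : S set0.
  split=> // e e0; exists fset0, set0; split; last first.
    by rewrite /approximates setD0 pr0 ltW.
  by case: (sigma_algebra_local fset0).
have SU B C : S B -> S C -> S (B `|` C).
  move=> [mB aB] [mC aC]; split; first exact: measurableU.
  move=> e e0; have e2 : 0 < e / 2 by rewrite divr_gt0.
  have [F [B' [FB' [h1 h2]]]] := aB _ e2; have [F' [C' [FC' [h3 h4]]]] := aC _ e2.
  have mB' := measurable_local FB'; have mC' := measurable_local FC'.
  exists (F `|` F')%fset, (B' `|` C'); split.
    have := sigma_algebra_local (F `|` F')%fset => -[s0 sC sU].
    rewrite -bigcup2E; apply: sU => -[|[|n]] /=.
    - exact: local_subset (fsubsetUl F F') FB'.
    - exact: local_subset (fsubsetUr F F') FC'.
    - exact: s0.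
  have sub (A A' D D' : set X) : measurable A -> measurable A' -> measurable D -> measurable D' ->
      pr P (A `\` A') <= e / 2 -> pr P (D `\` D') <= e / 2 ->
      pr P ((A `|` D) `\` (A' `|` D')) <= e.
    move=> mA mA' mD mD' AA' DD'; rewrite [e]splitr; apply: le_trans (lerD AA' DD').
    apply: le_trans (prU P (measurableD mA mA') (measurableD mD mD')).
    apply: pr_le.
    - by apply: measurableD; exact: measurableU.
    - by apply: measurableU; exact: measurableD.
    - by move=> x [[Ax|Dx] /not_orP[A'x D'x]]; [left | right].
  by split; exact: sub.
rewrite measurable_cylindersE; apply: smallest_sub; last first.
  move=> B [F _ FB]; have lB : local F B by exact: sub_sigma_algebra.
  split; first exact: measurable_local lB.
  by move=> e e0; exists F, B; split=> //; rewrite /approximates setDv pr0 ltW.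
split=> [//|B SB|B SB]; first by rewrite setTD; exact: SC.
have mU : measurable (\bigcup_k B k) by apply: bigcup_measurable => k _; case: (SB k).
split=> // e e0; have e2 : 0 < e / 2 by rewrite divr_gt0.
(* A finite partial union already captures the countable union up to [e / 2], and [SU] handles
   finite unions. *)
pose D n := \big[setU/set0]_(i < n) B i.
have SD n : S (D n).
  by rewrite /D; elim: n => [|n IHn]; rewrite ?big_ord0 // big_ord_recr; exact: SU.
have DU : \bigcup_k D k = \bigcup_k B k.
  apply/seteqP; split=> [x [n _]|x [n _ Bx]].
    by rewrite /D -bigcup_mkord => -[k _ Bx]; exists k.
  by exists n.+1 => //; rewrite /D -bigcup_mkord; exists n => /=.
have ndD : nondecreasing_seq D.
  by move=> m n mn; apply/subsetPset; exact: subset_bigsetU.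
have [n] := pr_bigcup P (fun n => (SD n).1) ndD e2.
rewrite DU => Dn; have [mD aD] := SD n.
have [F [B' [FB' [h1 h2]]]] := aD _ e2.
have mB' := measurable_local FB'.
have DsU : D n `<=` \bigcup_k B k by rewrite -DU => x Dx; exists n.
exists F, B'; split=> //; split; last first.
  apply: (le_trans _ (le_trans h2 _)); last by rewrite ler_pdivrMr // ler_peMr ?(ltW e0) // ler1n.
  by apply: pr_le; [exact: measurableD..|move=> x [B'x Ux]; split=> // /DsU].
have UD : pr P (\bigcup_k B k `\` D n) <= e / 2.
  move: Dn; rewrite (@pr_split _ _ _ P _ (D n) mU mD) setIC (setIidPl _ _).2 //.
  by rewrite lerD2l.
rewrite [e]splitr; apply: le_trans (lerD UD h1).
apply: le_trans (prU P (measurableD mU mD) (measurableD mD mB')).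
apply: pr_le; first exact: measurableD.
  by apply: measurableU; exact: measurableD.
move=> x [Ux B'x]; have [Dx|Dx] := pselect (D n x); [right|left]; by split.
Qed.

Lemma corr_close B B' g (e : R) : measurable B -> measurable B' -> approximates e B B' ->
  corr P sh B g - corr P sh B' g <= 4 * e.
Proof.
move=> mB mB' [h1 h2].
have mgB := measurable_act mp_bernoulli_shift g mB.
have mgB' := measurable_act mp_bernoulli_shift g mB'.
have le1 : pr P (sh g @` B `&` B) <= pr P (sh g @` B' `&` B') + e + e.
  have h3 : pr P (sh g @` (B `\` B')) <= e.
    by rewrite (pr_act mp_bernoulli_shift) //; exact: measurableD.
  have mD := measurableD mB mB'.
  have mgD := measurable_act mp_bernoulli_shift g mD.
  apply: le_trans (lerD (lerD (lexx _) h3) h1).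
  (* A point of [gB] and [B] that is not in both [gB'] and [B'] lies in [g(B \ B')] or in
     [B \ B']. *)
  apply: (@le_trans _ _ (pr P (sh g @` B' `&` B' `|` sh g @` (B `\` B') `|` B `\` B'))).
    apply: pr_le; [exact: measurableI| |].
      by apply: measurableU => //; apply: measurableU => //; exact: measurableI.
    move=> f [[f0 Bf0 f0E] Bf].
    have [B'f|B'f] := pselect (B' f); last by right.
    left; have [B'f0|B'f0] := pselect (B' f0); [left; split=> //|right].
      by exists f0.
    by exists f0.
  apply: (le_trans (prU P _ mD)).
    by apply: measurableU => //; exact: measurableI.
  rewrite lerD2r; apply: prU => //; exact: measurableI.
have le2 : pr P B' <= pr P B + e.
  rewrite (pr_split P mB' mB) lerD //.
  by apply: pr_le => //; exact: measurableI.
have b01 : 0 <= pr P B <= 1 by rewrite pr_ge0 pr_le1.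
have b'01 : 0 <= pr P B' <= 1 by rewrite pr_ge0 pr_le1.
have e0 : 0 <= e by apply: le_trans h1; exact: pr_ge0.
exact: sqr_close.
Qed.

Lemma tempered_corr_bernoulli B : measurable B -> tempered (corr P sh B).
Proof.
move=> mB; apply: tempered_lim => s e e0.
have e4 : 0 < e / 4 by rewrite divr_gt0.
have [F [B' [FB' BB']]] := local_approx mB e4.
exists (corr P sh B'); first exact: tempered_corr_local FB'.
have mB' := measurable_local FB'.
move=> g _; have := corr_close g mB mB' BB'.
have BB'C : approximates (e / 4) B' B by case: BB'.
have := corr_close g mB' mB BB'C.
move: (corr P sh B g) (corr P sh B' g) => x y h1 h2.
by rewrite ler_norml; apply/andP; split; lra.
Qed.

End Bernoulli.

(** * Actions weakly contained in the Bernoulli shift *)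

Lemma tempered_corr_weakly_contained (R : realType) (G : groupType)
    (P : probability (shift_space R G) R) d (X : measurableType d)
    (mu : probability X R) (a : G -> X -> X) (A : set X) :
  product_lebesgue P -> mp_action mu a ->
  weakly_contained mu a P (@bernoulli_shift R G) -> measurable A ->
  tempered (corr mu a A).
Proof.
move=> PE mp wc mA; apply: tempered_lim => s e e0.
(* Including [1] makes weak containment compare the measures of [A] and [B] themselves, whose
   squares enter [corr]. *)
pose F : {fset G} := [fset g | g in 1%g :: s]%fset.
(* One third is for the intersections; the squares of two numbers in [[0, 1]] differ by at most
   twice their distance, which takes the other two. *)
have e3 : 0 < e / 3 by rewrite divr_gt0.
have [B mB BA] := wc 1%N (fun=> A) F _ (fun=> mA) e3.
have act1E (T : Type) (b : G -> T -> T) (C : set T) :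
    (forall x, b 1%g x = x) -> (b 1%g @` C) `&` C = C.
  move=> b1; apply/seteqP; split=> [x []//|x Cx]; split=> //.
  by exists x; rewrite ?b1.
have mpB := mp_bernoulli_shift PE.
exists (corr P (@bernoulli_shift R G) (B ord0)).
  exact: tempered_corr_bernoulli.
move=> g gs.
have h1 : `|pr mu (a g @` A `&` A) - pr P (bernoulli_shift g @` B ord0 `&` B ord0)| <= e / 3.
  by apply/ltW/BA; rewrite in_fset /= inE gs orbT.
have h2 : `|pr mu A - pr P (B ord0)| <= e / 3.
  have := BA 1%g ord0 ord0; rewrite !act1E.
  - by move=> h; apply/ltW/h; rewrite in_fset /= inE eqxx.
  - by move=> x; rewrite (act1 mpB).
  - by move=> x; rewrite (act1 mp).
have b01 : 0 <= pr mu A <= 1 by rewrite pr_ge0 pr_le1.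
have b'01 : 0 <= pr P (B ord0) <= 1 by rewrite pr_ge0 pr_le1.
rewrite /corr; move: h1 h2 b01 b'01.
move: (pr mu A) (pr P (B ord0)) => b b'.
move: (pr mu _) (pr P _) => x y h1 h2 b01 b'01.
have h3 : `|b ^+ 2 - b' ^+ 2| <= 2 * (e / 3).
  rewrite subr_sqr normrM mulrC; apply: ler_pM => //.
  move: b01 b'01; clear=> /andP[? ?] /andP[? ?]; rewrite ger0_norm; lra.
rewrite (_ : _ - _ = (x - y) - (b ^+ 2 - b' ^+ 2)); last by ring.
apply: (le_trans (ler_normB _ _)); apply: (le_trans (lerD h1 h3)).
by clear; lra.
Qed.

(** * Countable separation of points in standard Borel spaces *)

Section Separation.
Context (R : realType) d (X : measurableType d).

(** The sets are pulled back from balls of radius [1 / m.+1] centred at the points of a countable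
    dense set. *)
Lemma standard_borel_separated : standard_borel R X ->
  exists2 E : nat -> set X, forall n, measurable (E n) &
    forall x y, (forall n, E n x <-> E n y) -> x = y.
Proof.
move=> [Y [f [hY [D /countable_injP[c c_inj] dD] f_bij mX]]].
pose pt n : Y := xget point [set p | D p /\ c p = n].
have ptE p : D p -> pt (c p) = p.
  move=> Dp; rewrite /pt; case: xgetP => [q _ [Dq cq]|/(_ p)/=]; last by case.
  by apply: c_inj; rewrite ?inE.
(* Interiors are taken because a ball of a pseudometric structure need not be open. *)
pose U (k : nat * nat) : set Y := interior (ball (pt k.1) (k.2.+1%:R^-1)).
(* Integers that code no pair give the whole space, which separates nothing. *)
pose E n : set X := oapp (fun k => f @^-1` U k) setT (choice.unpickle n).
exists E.
  move=> n; rewrite /E; case: (choice.unpickle n) => [k|] /=; last exact: measurableT.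
  rewrite mX; exists (U k); last by rewrite setTI.
  by apply: sub_sigma_algebra; exact: open_interior.
move=> x y xy; apply: (bij_inj f_bij); apply: contrapT => fxy.
have := hY; rewrite open_hausdorff => /(_ (f x) (f y)).
case; first exact/eqP.
move=> [V W] /= [/set_mem Vx /set_mem Wy] [oV oW VW].
have /nbhs_ballP[e /= e0 eV] : nbhs (f x) V by exact: open_nbhs_nbhs.
have [m me] : exists m, (m.+1%:R^-1 : R) + m.+1%:R^-1 <= e.
  have e2 : 0 < 2 / e by rewrite divr_gt0.
  have h : ((Num.trunc (2 / e)).+1%:R^-1 : R) <= e / 2.
    rewrite -(invrK (e / 2)) invf_div lef_pV2 ?posrE ?ltr0Sn //.
    exact/ltW/truncnS_gt.
  by exists (Num.trunc (2 / e)); rewrite [leRHS]splitr lerD.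
(* Half the radius of the ball around [q]: as [q] is [r]-close to [f x], that ball contains the
   [r]-ball around [f x]. *)
pose r : R := (m.+1 + m.+1)%:R^-1.
have rE : r + r = m.+1%:R^-1.
  rewrite /r natrD; move: (m.+1%:R : R) => u.
  by rewrite -[u + u]mulr2n -mulr_natl invfM; lra.
have r0 : 0 < r by rewrite invr_gt0 ltr0n.
have oB : open (interior (ball (f x) r)) by exact: open_interior.
have [|q [qB Dq]] := dD _ _ oB.
  by exists (f x); exact: (nbhs_singleton (nbhs_interior (nbhsx_ballx _ _ r0))).
have xq : ball (f x) r q := interior_subset qB.
have Ux : U (c q, m) (f x).
  rewrite /U /= ptE //; apply/nbhs_ballP; exists r => //= z xz.
  by rewrite -rE; apply: ball_triangle xz; exact: ball_sym.
have Uy : U (c q, m) (f y).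
  by have := (xy (choice.pickle (c q, m))).1; rewrite /E choice.pickleK /=; apply.
have qy : ball q m.+1%:R^-1 (f y).
  by have := interior_subset Uy; rewrite /= ptE.
have Vy : V (f y).
  apply: eV; apply: (le_ball me); apply: ball_triangle qy.
  by apply: le_ball xq; rewrite -rE lerDl ltW.
by have : (V `&` W) (f y) by []; rewrite (eqP VW).
Qed.

End Separation.

Section FiniteAdditivity.
Context (R : realType) d (X : measurableType d) (mu : probability X R).

Lemma pr_partition (S : finType) (c : X -> S) (Z : set X) :
  (forall s, measurable [set x | c x = s]) -> measurable Z ->
  pr mu Z = \sum_s pr mu (Z `&` [set x | c x = s]).
Proof.
move=> mc mZ.
have key (l : seq S) : uniq l ->
    pr mu (Z `&` [set x | c x \in l]) = \sum_(s <- l) pr mu (Z `&` [set x | c x = s]) /\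
    measurable [set x | c x \in l].
  elim: l => [_|s l IHl /= /andP[sl /IHl[IH ml]]].
    have -> : [set x | c x \in [::]] = set0 by apply/seteqP; split.
    by rewrite setI0 big_nil pr0.
  have E : [set x | c x \in s :: l] = [set x | c x = s] `|` [set x | c x \in l].
    apply/seteqP; split=> x /=; rewrite inE; first by case/orP=> [/eqP|]; [left|right].
    by case=> [->|->]; rewrite ?eqxx ?orbT.
  have mE : measurable [set x | c x \in s :: l] by rewrite E; exact: measurableU.
  split=> //; rewrite big_cons -IH (@pr_split _ _ _ mu _ [set x | c x = s]) //; last exact: measurableI.
  rewrite E; congr (pr mu _ + pr mu _); apply/seteqP; split=> x /=.
  - by case=> -[].
  - by case; split=> //; split=> //; left.
  - by case=> -[Zx [//|cl] _].
  - case=> Zx cl; split; first by split=> //; right.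
    by move=> cs; rewrite cs (negPf sl) in cl.
have [<- _] := key _ (index_enum_uniq S).
by congr pr; apply/seteqP; split=> [x Zx|x []//]; split=> //=; exact: mem_index_enum.
Qed.

Lemma pr_seq (s : seq X) : (forall x : X, measurable [set x]) -> uniq s ->
  pr mu ([set x | x \in s] : set X) = \sum_(x <- s) pr mu [set x] /\ measurable ([set x | x \in s] : set X).
Proof.
move=> m1; elim: s => [_|x s IHs /= /andP[xs /IHs[IH ms]]].
  have -> : [set x : X | x \in [::]] = set0 by apply/seteqP; split.
  by rewrite big_nil pr0.
have E : ([set y | y \in x :: s] : set X) = [set x] `|` [set y | y \in s].
  apply/seteqP; split=> y /=; rewrite inE; first by case/orP=> [/eqP|]; [left|right].
  by case=> [->|->]; rewrite ?eqxx ?orbT.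
have mE : measurable ([set y | y \in x :: s] : set X) by rewrite E; exact: measurableU.
split=> //; rewrite big_cons -IH (@pr_split _ _ _ mu _ [set x]) // E.
congr (pr mu _ + pr mu _); apply/seteqP; split=> y /=.
- by case.
- by move=> ->; split=> //; left.
- by case=> -[].
- by move=> ys; split; [right | move=> yx; rewrite yx (negPf xs) in ys].
Qed.

End FiniteAdditivity.

(** * Cells of a refining sequence of finite partitions *)

Section Cells.
Context (R : realType) d (X : measurableType d) (mu : probability X R).
Variable E : nat -> set X.
Hypothesis mE : forall n, measurable (E n).
Hypothesis E_sep : forall x y, (forall n, E n x <-> E n y) -> x = y.

(** Labels the cell of [x] in the partition generated by the first [n] sets. *)
Definition code n (x : X) : {ffun 'I_n -> bool} := [ffun i : 'I_n => `[< E i x >]].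

Lemma code_eqP n x y : code n x = code n y <-> forall i, (i < n)%N -> (E i x <-> E i y).
Proof.
split=> [/ffunP h i ni|h].
  have := h (Ordinal ni); rewrite !ffunE /= => e.
  by split=> Ei; apply/asboolP; [rewrite -e | rewrite e]; apply/asboolP.
by apply/ffunP => i; rewrite !ffunE; apply/asbool_equiv_eq/h.
Qed.

Lemma code_mono m n x y : (m <= n)%N -> code n x = code n y -> code m x = code m y.
Proof.
move=> mn /code_eqP h; apply/code_eqP => i im.
by apply: h; exact: leq_trans im mn.
Qed.

Lemma code_sep x y : (forall n, code n x = code n y) -> x = y.
Proof. by move=> h; apply: E_sep => n; have /code_eqP := h n.+1; apply. Qed.

Lemma measurable_code_pred n (Q : {ffun 'I_n -> bool} -> Prop) :
  measurable [set x | Q (code n x)].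
Proof.
have m1 s : measurable [set x | code n x = s].
  have -> : [set x | code n x = s] =
      \bigcap_(i in [set: 'I_n]) (if s i then E i else ~` E i).
    apply/seteqP; split=> [x <- i _|x h].
      by rewrite ffunE; case: asboolP.
    apply/ffunP => i; rewrite ffunE; have := h i I.
    by case: (s i) => hx; [apply/asboolP | apply/asboolPn].
  apply: fin_bigcap_measurable => [|i _]; first exact: finite_finset.
  by case: (s i) => //; exact: measurableC.
rewrite (_ : [set x | _] = \bigcup_(s in [set s | Q s]) [set x | code n x = s]).
  by apply: fin_bigcup_measurable => [|s _]; [exact: finite_finset | exact: m1].
by apply/seteqP; split=> [x Qx|x [s Qs /= xs]]; [exists (code n x) | rewrite xs].
Qed.

Lemma measurable_singleton (x : X) : measurable [set x].
Proof.
rewrite (_ : [set x] = \bigcap_n [set y | code n y = code n x]).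
  by apply: bigcap_measurableType => n _; exact: (measurable_code_pred (fun s => s = _)).
by apply/seteqP; split=> [y -> //|y h]; apply: code_sep => n; exact: h.
Qed.

Lemma cells_small (e : R) : (forall x, pr mu [set x] = 0) -> 0 < e ->
  exists n0, forall n, (n0 <= n)%N -> \sum_s pr mu [set x | code n x = s] ^+ 2 <= e.
Proof.
move=> atomless e0; have e2 : 0 < e / 2 by rewrite divr_gt0.
pose w n (s : {ffun 'I_n -> bool}) := pr mu [set x | code n x = s].
(* The union of the cells of mass larger than e/2; it decreases to the empty
   set, and the other cells contribute at most e/2. *)
pose H n := [set x | e / 2 < w n (code n x)].
have mH n : measurable (H n) by exact: (measurable_code_pred (fun s => e / 2 < w n s)).
have wmono m n x : (m <= n)%N -> w n (code n x) <= w m (code m x).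
  move=> mn; apply: pr_le.
  - exact: (measurable_code_pred (fun s => s = _)).
  - exact: (measurable_code_pred (fun s => s = _)).
  - by move=> y /=; exact: code_mono.
have niH : nonincreasing_seq H.
  move=> m n mn; apply/subsetPset => x /= h; apply: (lt_le_trans h); exact: wmono.
have H0 : \bigcap_n H n = set0.
  apply/seteqP; split=> // x Hx.
  (* The cells of [x] decrease to the null set [[set x]], so their masses cannot all exceed
     [e / 2]. *)
  have := @pr_bigcap _ _ _ mu (fun n => [set y | code n y = code n x]) (e / 2).
  case=> //.
  - by move=> n; exact: (measurable_code_pred (fun s => s = _)).
  - by move=> m n mn; apply/subsetPset => y /=; exact: code_mono.
  move=> n; rewrite (_ : \bigcap_k _ = [set x]); last first.
    by apply/seteqP; split=> [y h|y -> //]; apply: code_sep => k; exact: h.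
  rewrite atomless add0r leNgt => /negP; apply; exact: Hx.
have [n0] := pr_bigcap mu mH niH e2; rewrite H0 pr0 add0r => Hn0.
exists n0 => n n0n.
have Hn : pr mu (H n) <= e / 2.
  apply: le_trans Hn0; apply: pr_le => //; exact/subsetPset/niH.
have mc s : measurable [set x | code n x = s].
  exact: (measurable_code_pred (fun s' => s' = s)).
rewrite [e]splitr; apply: (@le_trans _ _ (e / 2 * pr mu setT + pr mu (H n))); last first.
  by rewrite prT mulr1 lerD2l.
rewrite (pr_partition mu mc measurableT) (pr_partition mu mc (mH n)).
rewrite mulr_sumr -big_split /=; apply: ler_sum => s _; rewrite setTI -/(w n s).
have w0 : 0 <= w n s by exact: pr_ge0.
have w1 : w n s <= 1 by apply: pr_le1; exact: mc.
have [ws|ws] := ltP (e / 2) (w n s).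
  rewrite (_ : H n `&` _ = [set x | code n x = s]) -/(w n s).
    by rewrite expr2; apply: (@le_trans _ _ (w n s)); [rewrite ler_piMr | rewrite lerDr mulr_ge0 // ltW].
  by apply/seteqP; split=> [x []//|x /= xs]; split=> //=; rewrite /H /= xs.
apply: (@le_trans _ _ (e / 2 * w n s)); last by rewrite lerDl pr_ge0.
by rewrite expr2 ler_wpM2r.
Qed.

End Cells.

(** * Fixed points and atoms *)

Section FixedPoints.
Context (R : realType) (G : groupType) d (X : measurableType d) (mu : probability X R).
Variable a : G -> X -> X.
Hypothesis mp : mp_action mu a.
Hypothesis corr_tempered : forall A, measurable A -> tempered (corr mu a A).
Variable E : nat -> set X.
Hypothesis mE : forall n, measurable (E n).
Hypothesis E_sep : forall x y, (forall n, E n x <-> E n y) -> x = y.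

Let fixpts g := [set x | a g x = x].

(** The union over the cells [C] of level [n] of [gC] intersected with [C]; it decreases to
    [fixpts g] as [n] grows. *)
Let same n g := [set x | code E n (a g^-1%g x) = code E n x].

Let measurable_code_eq n s : measurable [set x | code E n x = s].
Proof. exact: (measurable_code_pred mE (fun s' => s' = s)). Qed.

Let same_partition n g s : same n g `&` [set x | code E n x = s] =
  (a g @` [set x | code E n x = s]) `&` [set x | code E n x = s].
Proof.
rewrite (act_image mp); apply/seteqP; rewrite /same.
by split=> x /= [h1 h2]; split; rewrite ?h1 ?h2.
Qed.

Let measurable_same n g : measurable (same n g).
Proof.
rewrite (_ : same n g = \bigcup_(s in [set: {ffun 'I_n -> bool}])
   ((a g @` [set x | code E n x = s]) `&` [set x | code E n x = s])).
  apply: fin_bigcup_measurable => [|s _]; first exact: finite_finset.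
  by apply: measurableI => //; exact: (measurable_act mp).
apply/seteqP; split=> [x xs|x [s _]].
  by exists (code E n x) => //; rewrite -same_partition.
by rewrite -same_partition => -[].
Qed.

Let bigcap_same g : \bigcap_n same n g = fixpts g.
Proof.
apply/seteqP; split=> [x h|x gx n _] /=.
  have e : a g^-1%g x = x by apply: (code_sep E_sep) => n; exact: h.
  by rewrite /fixpts /= -[in LHS]e (actVK mp).
by rewrite /same /= -{1}gx (actK mp).
Qed.

Let nonincreasing_same g : nonincreasing_seq (same ^~ g).
Proof. by move=> m n mn; apply/subsetPset => x; exact: code_mono. Qed.

Lemma measurable_fixpts g : measurable (fixpts g).
Proof. by rewrite -bigcap_same; exact: bigcap_measurableType. Qed.

Let sum_corr n g : \sum_s corr mu a [set x | code E n x = s] g =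
  pr mu (same n g) - \sum_s pr mu [set x | code E n x = s] ^+ 2.
Proof.
rewrite (pr_partition mu (@measurable_code_eq n) (measurable_same n g)).
by rewrite -sumrB; apply: eq_bigr => s _; rewrite same_partition.
Qed.

Lemma tempered_fixpts : (forall x, pr mu [set x] = 0) -> tempered (fun g => pr mu (fixpts g)).
Proof.
move=> atomless; apply: tempered_lim => s e e0.
have [n1 Hn1] := cells_small mE E_sep atomless e0.
have [n2 Hn2] : exists n0, forall n g, (n0 <= n)%N -> g \in s ->
    pr mu (same n g) <= pr mu (fixpts g) + e.
  elim: s => [|g s [n0 IH]]; first by exists 0.
  have [m] := pr_bigcap mu (measurable_same ^~ g) (@nonincreasing_same g) e0.
  rewrite bigcap_same => Hm; exists (maxn n0 m) => n h; rewrite geq_max => /andP[n0n mn].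
  rewrite inE => /predU1P[->|hs]; last exact: IH.
  apply: le_trans Hm; apply: pr_le; try exact: measurable_same.
  exact/subsetPset/nonincreasing_same.
pose n := maxn n1 n2.
exists (fun g => \sum_t corr mu a [set x | code E n x = t] g).
  by apply: tempered_sum => t; exact: corr_tempered.
move=> g gs; rewrite sum_corr.
have := Hn1 n (leq_maxl _ _); have := Hn2 n g (leq_maxr _ _) gs.
have : 0 <= \sum_t pr mu [set x | code E n x = t] ^+ 2.
  by apply: sumr_ge0 => t _; exact: sqr_ge0.
have : pr mu (fixpts g) <= pr mu (same n g).
  apply: pr_le; [exact: measurable_fixpts|exact: measurable_same|].
  by rewrite -bigcap_same => x; apply.
move: (pr mu _) (pr mu _) (\sum_t _) => u v w h1 h2 h3 h4.
by rewrite ler_norml; apply/andP; split; lra.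
Qed.

(** The preimage under [h] of the fixed points of [h * g] is the set of fixed points of [g * h], and
    [h] preserves [mu]. *)
Lemma pr_fixptsC g h : pr mu (fixpts (g * h)%g) = pr mu (fixpts (h * g)%g).
Proof.
rewrite -[RHS](pr_act_preimage mp h); last exact: measurable_fixpts.
congr pr; apply/seteqP; split=> x; rewrite /fixpts /= !(actM mp).
  by move=> ->.
by move=> /(can_inj (actK mp h)).
Qed.

Lemma fixpts1 : fixpts 1%g = setT.
Proof. by apply/seteqP; split=> // x _; rewrite /fixpts /= (act1 mp). Qed.

(** * Atoms of a given mass *)

Section Atoms.
Variable x0 : X.
Hypothesis x0_atom : 0 < pr mu [set x0].

Let p := pr mu [set x0].
Let O := [set y | pr mu [set y] = p].

Let m1 : forall x : X, measurable [set x] := measurable_singleton mE E_sep.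

(** More than [1 / p] points of mass [p] would have total mass above [1]. *)
Lemma finite_atoms : finite_set O.
Proof.
apply: contrapT => infO.
have [B BO Bn] := infinite_set_fset (Num.trunc p^-1).+1 infO.
have [sB mB] := pr_seq mu m1 (fset_uniq B).
have := pr_le1 mu mB; rewrite sB (eq_big_seq (fun=> p)); last first.
  by move=> y yB; have := BO y yB.
rewrite big_const_seq count_predT iter_addr_0 leNgt => /negP; apply.
rewrite -mulr_natl -ltr_pdivrMr // div1r; apply: (lt_le_trans (truncnS_gt _)).
by rewrite ler_nat.
Qed.

Let s : seq X := fset_set O.

Let mem_s y : (y \in s) = (y \in O).
Proof. by rewrite in_fset_set //; exact: finite_atoms. Qed.

Let act_s g y : (a g y \in s) = (y \in s).
Proof.
rewrite !mem_s; apply/idP/idP; rewrite !inE /O /=.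
  move=> <-; rewrite -(pr_act mp g (m1 y)); congr pr.
  by rewrite image_set1.
by move=> <-; rewrite -(pr_act mp g (m1 y)); congr pr; rewrite image_set1.
Qed.

Let corr_atom y g : y \in s -> corr mu a [set y] g = p * (a g y == y)%:R - p ^+ 2.
Proof.
rewrite mem_s inE /O /corr /= => yp; rewrite yp image_set1; congr (_ - _).
case: eqP => [->|gy]; first by rewrite setIid yp mulr1.
rewrite mulr0 (_ : _ `&` _ = set0) ?pr0 //.
by apply/seteqP; split=> // z [/= -> ].
Qed.

(** Equals [p] times the number of points of [s] fixed by [g], minus a constant; summing over the
    whole invariant set [s] makes it a class function. *)
Let phi g := \sum_(y <- s) corr mu a [set y] g.

Let tempered_phi : tempered phi.
Proof. by apply: tempered_sum => y; exact: corr_tempered. Qed.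

Let phiE g : phi g = \sum_(y <- s) (p * (a g y == y)%:R - p ^+ 2).
Proof. by apply: eq_big_seq => y ys; rewrite corr_atom. Qed.

Let phiC g h : phi (g * h)%g = phi (h * g)%g.
Proof.
rewrite !phiE [RHS](perm_big [seq a h y | y <- s]) /=; last first.
  apply: uniq_perm; first exact: fset_uniq.
    by rewrite (map_inj_uniq (can_inj (actK mp h))) fset_uniq.
  move=> y; apply/idP/mapP => [ys|[z zs ->]]; last by rewrite act_s.
  by exists (a h^-1%g y); rewrite ?act_s // (actVK mp).
rewrite big_map; apply: eq_bigr => y _; congr (p * (nat_of_bool _)%:R - _).
by rewrite !(actM mp) (inj_eq (can_inj (actK mp h))).
Qed.

Let x0s : x0 \in s.
Proof. by rewrite mem_s inE. Qed.

Let p_lt1 : ~ point_mass mu -> p < 1.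
Proof.
move=> npm; rewrite lt_neqAle pr_le1 // andbT; apply/negP => /eqP p1.
apply: npm; exists x0 => A mA; rewrite -prE // diracE; congr (_%:E).
have [Ax0|Ax0] := boolP (x0 \in A) => /=.
  apply/eqP; rewrite eq_le pr_le1 //= -p1; apply: pr_le => //.
  by move=> y ->; move: Ax0; rewrite inE.
apply/eqP; rewrite eq_le pr_ge0 andbT.
have := @pr_le _ _ _ mu _ _ mA (measurableC (m1 x0)).
rewrite prC // -/p p1 subrr; apply.
by move=> y Ay /= yx0; move: Ax0; rewrite notin_setE -yx0.
Qed.

Lemma sum_corr_atoms_gt0 g : ~ point_mass mu -> (forall y, y \in s -> a g y = y) -> 0 < phi g.
Proof.
move=> npm gs; rewrite phiE.
rewrite (eq_big_seq (fun=> p * (1 - p))); last first.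
  by move=> y ys; rewrite gs // eqxx mulrBr expr2.
rewrite big_const_seq count_predT iter_addr_0 pmulrn_lgt0; last first.
  by rewrite lt0n size_eq0; apply/negP => /eqP s0; move: x0s; rewrite s0.
by rewrite mulr_gt0 // subr_gt0 p_lt1.
Qed.

Lemma atom_point_mass : unique_trace_property R G -> ~ finite_set [set: G] -> point_mass mu.
Proof.
move=> uniq_tr infG; apply: contrapT => npm.
pose S : {fset X} := fset_set O.
(* The action of [g] on the finite set [S]; the default value of [insubd] never occurs because [S]
   is invariant. *)
pose F (g : G) : {ffun S -> S} := [ffun y => insubd y (a g (val y))].
have Fval g y : val (F g y) = a g (val y).
  by rewrite ffunE insubdK // -/s; exact: etrans (act_s g _) (valP y).
(* An infinite group has only finitely many images under [F], so two elements act alike on [S] and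
   their quotient fixes [S] pointwise. *)
have /existsNP[g /existsNP[h /not_implyP[Fgh /eqP gh]]] : ~ injective F.
  move=> injF; apply: infG.
  rewrite (_ : setT = F @^-1` setT) //; apply: finite_preimage; last exact: finite_finset.
  by move=> g h _ _; exact: injF.
have k1 : (g^-1 * h)%g != 1%g by rewrite -(inj_eq (mulgI g)) mulVKg mulg1 eq_sym.
have k0 : 0 < phi (g^-1 * h)%g.
  apply: sum_corr_atoms_gt0 => // y ys; rewrite (actM mp).
  have := Fval h (FSetSub ys); rewrite -Fgh Fval /= => <-.
  exact: (actK mp).
have phi1 : 0 < phi 1%g by apply: sum_corr_atoms_gt0 => // y _; exact: (act1 mp).
by move: k0; rewrite (unique_trace_tempered uniq_tr tempered_phi phi1 phiC k1) ltxx.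
Qed.

End Atoms.

End FixedPoints.

Theorem theorem1p2 (R : realType) (G : groupType) (G_countable : countable [set: G]) :
  unique_trace_property R G -> shift_minimal R G.
Proof.
move=> uniq_tr P PE d X mu a sbX mp npm wc g g1.
have [Gfin|Ginf] := pselect (finite_set [set: G]).
  (* For finite [G] the constant function [1] would have to vanish at [g]. *)
  have := unique_trace_tempered uniq_tr (tempered_finite R Gfin) ltr01 (fun _ _ => erefl) g1.
  by move/eqP; rewrite oner_eq0.
have corr_t A := @tempered_corr_weakly_contained R G P d X mu a A PE mp wc.
have [E mE E_sep] := standard_borel_separated sbX.
have atomless x : pr mu [set x] = 0.
  apply/eqP; rewrite eq_le pr_ge0 andbT leNgt; apply/negP => x0.
  exact: npm (atom_point_mass mp corr_t mE E_sep x0 uniq_tr Ginf).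
have mfix := measurable_fixpts mp mE E_sep g.
rewrite -(prE mu mfix); congr (_%:E).
apply: (unique_trace_tempered uniq_tr (tempered_fixpts mp corr_t mE E_sep atomless)) => //.
  by rewrite (fixpts1 mp) prT.
exact: (pr_fixptsC mp mE E_sep).
Qed.
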